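(* Let $R$ be a commutative ring and let $\underline{S}=(S_1,\ldots,S_d)$ be a $d$-tuple of multiplicative systems in $R$. If $d\leq k\leq n\leq\infty$, then the map $K(R\text{ on }\underline{S},k)\to K(R\text{ on }\underline{S},n)$ induced by the inclusion $\mathcal{P}(R,k)\hookrightarrow\mathcal{P}(R,n)$ is an isomorphism.
   Context: Here $d\geq 1$. All chain complexes vanish in negative degrees. $\mathcal{P}(R)$ denotes the category of bounded chain complexes $P_\bullet$ of $R$-modules such that $P_i=0$ for $i<0$ and each $P_i$ is a finitely-generated projective $R$-module. For an integer $n\geq 0$, $\mathcal{P}(R,n)$ is the full subcategory of $\mathcal{P}(R)$ consisting of complexes with $P_i=0$ for $i\notin[0,n]$; also $\mathcal{P}(R,\infty)=\mathcal{P}(R)$. A chain complex $C_\bullet$ of $R$-modules is $\underline{S}$-exact if $S_i^{-1}C_\bullet$ is exact for every $i=1,\ldots,d$. For $0\leq n\leq\infty$, $K(R\text{ on }\underline{S},n)$ is the quotient of the free abelian group on the isomorphism classes of $\underline{S}$-exact objects $P_\bullet$ of $\mathcal{P}(R,n)$ by the relations: (1) $[P_\bullet]=[P'_\bullet]+[P''_\bullet]$ whenever $0\to P'_\bullet\to P_\bullet\to P''_\bullet\to 0$ is a short exact sequence of such complexes; (2) $[P_\bullet]=0$ if $H_*(P_\bullet)=0$. *)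

(* Defs.v *)
From HB Require Import structures.
From mathcomp Require Import all_boot all_order all_algebra.
From mathcomp Require Import generic_quotient ring boolp.

Set Implicit Arguments.
Unset Strict Implicit.
Unset Printing Implicit Defensive.

Import GRing.Theory.
Local Open Scope quotient_scope.
Local Open Scope ring_scope.

(** A complex of R-modules is a family of [lmodType R], so the type of all
    complexes lives strictly above the single universe shared by all carriers
    of MathComp structures.  In particular it is not a [choiceType], and the
    free abelian group on it cannot be a [zmodType].  The three constructions
    on abelian groups used below are therefore carried out on a plain record. *)

Section ClassQuotient.
Variables (T : Type) (e : T -> T -> Prop).

(* Equivalence classes represented as predicates on [T]. *)
Definition classes := {A : T -> Prop | exists x, A = e x}.

Definition class_of (x : T) : classes := exist _ (e x) (ex_intro _ x erefl).

Lemma classes_surj (q : classes) : exists x, class_of x = q.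
Proof.
case: q => A [x Ax]; exists x; apply: eq_exist => /=; exact/esym.
Qed.

Definition quot_repr (q : classes) : T := projT1 (cid (classes_surj q)).

Lemma quot_reprK q : class_of (quot_repr q) = q.
Proof. exact: projT2 (cid (classes_surj q)). Qed.

Hypothesis e_refl : forall x, e x x.
Hypothesis e_sym : forall x y, e x y -> e y x.
Hypothesis e_trans : forall x y z, e x y -> e y z -> e x z.

Lemma class_ofP x y : class_of x = class_of y <-> e x y.
Proof.
split=> [/(congr1 sval) /= exy|exy]; first by rewrite exy; exact: e_refl.
apply: eq_exist => /=; apply/funext => z; apply/propext.
by split; [exact: e_trans (e_sym exy)|exact: e_trans exy].
Qed.

Lemma quot_repr_class x : e (quot_repr (class_of x)) x.
Proof. by apply/class_ofP; rewrite quot_reprK. Qed.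

End ClassQuotient.

Record abGroup := AbGroup {
  ab_sort :> Type;
  ab_zero : ab_sort;
  ab_opp : ab_sort -> ab_sort;
  ab_add : ab_sort -> ab_sort -> ab_sort;
  ab_addA : associative ab_add;
  ab_addC : commutative ab_add;
  ab_add0 : left_id ab_zero ab_add;
  ab_addN : left_inverse ab_zero ab_opp ab_add
}.
Arguments ab_zero {_}.

Record abHom (G H : abGroup) := AbHom {
  ab_fun :> G -> H;
  ab_funD : forall x y, ab_fun (ab_add x y) = ab_add (ab_fun x) (ab_fun y)
}.

Section AbGroupTheory.
Variable G : abGroup.
Implicit Types x y z : G.

Lemma ab_addr0 x : ab_add x ab_zero = x.
Proof. by rewrite ab_addC ab_add0. Qed.

Lemma ab_addrN x : ab_add x (ab_opp x) = ab_zero.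
Proof. by rewrite ab_addC ab_addN. Qed.

Lemma ab_addIr x y z : ab_add x z = ab_add y z -> x = y.
Proof.
move=> /(congr1 (fun t => ab_add t (ab_opp z))).
by rewrite -!ab_addA ab_addrN !ab_addr0.
Qed.

Lemma ab_addACA x y z t :
  ab_add (ab_add x y) (ab_add z t) = ab_add (ab_add x z) (ab_add y t).
Proof.
by rewrite -!ab_addA; congr ab_add; rewrite !ab_addA (ab_addC y).
Qed.

Lemma ab_opp_unique x y : ab_add y x = ab_zero -> y = ab_opp x.
Proof. by move=> yx; apply: (@ab_addIr _ _ x); rewrite yx ab_addN. Qed.

Lemma ab_oppK x : ab_opp (ab_opp x) = x.
Proof. by apply/esym/ab_opp_unique/ab_addrN. Qed.

Lemma ab_opp0 : ab_opp ab_zero = ab_zero :> G.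
Proof. by apply/esym/ab_opp_unique; rewrite ab_add0. Qed.

Lemma ab_oppD x y : ab_opp (ab_add x y) = ab_add (ab_opp x) (ab_opp y).
Proof.
by apply/esym/ab_opp_unique; rewrite ab_addACA !ab_addN ab_add0.
Qed.

End AbGroupTheory.

Section AbHomTheory.
Variables (G H : abGroup) (f : abHom G H).

Lemma ab_fun0 : f ab_zero = ab_zero.
Proof.
by apply: (@ab_addIr _ _ _ (f ab_zero)); rewrite -ab_funD !ab_add0.
Qed.

Lemma ab_funN x : f (ab_opp x) = ab_opp (f x).
Proof. by apply: ab_opp_unique; rewrite -ab_funD ab_addN ab_fun0. Qed.

End AbHomTheory.

Section FreeAbelian.
Variable X : Type.

(* Formal expressions in the generators, modulo the abelian group laws. *)
Inductive free_term : Type :=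
| FGen of X
| FZero
| FOpp of free_term
| FAdd of free_term & free_term.

Inductive free_eq : free_term -> free_term -> Prop :=
| feq_refl x : free_eq x x
| feq_sym x y : free_eq x y -> free_eq y x
| feq_trans x y z : free_eq x y -> free_eq y z -> free_eq x z
| feq_opp x y : free_eq x y -> free_eq (FOpp x) (FOpp y)
| feq_add x x' y y' :
    free_eq x x' -> free_eq y y' -> free_eq (FAdd x y) (FAdd x' y')
| feq_addA x y z : free_eq (FAdd x (FAdd y z)) (FAdd (FAdd x y) z)
| feq_addC x y : free_eq (FAdd x y) (FAdd y x)
| feq_add0 x : free_eq (FAdd FZero x) x
| feq_addN x : free_eq (FAdd (FOpp x) x) FZero.

Definition free_sort := classes free_eq.
Definition free_zero : free_sort := class_of free_eq FZero.
Definition free_opp (x : free_sort) : free_sort :=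
  class_of free_eq (FOpp (quot_repr x)).
Definition free_add (x y : free_sort) : free_sort :=
  class_of free_eq (FAdd (quot_repr x) (quot_repr y)).

Let freeP := class_ofP feq_refl feq_sym feq_trans.
Let free_reprP := quot_repr_class feq_refl feq_sym feq_trans.

Lemma free_oppE x : free_opp (class_of free_eq x) = class_of free_eq (FOpp x).
Proof. by apply/freeP; apply: feq_opp; exact: free_reprP. Qed.

Lemma free_addE x y :
  free_add (class_of free_eq x) (class_of free_eq y) =
  class_of free_eq (FAdd x y).
Proof. by apply/freeP; apply: feq_add; exact: free_reprP. Qed.

Lemma free_addA : associative free_add.
Proof.
move=> x y z; rewrite -(quot_reprK x) -(quot_reprK y) -(quot_reprK z).
by rewrite !free_addE; apply/freeP/feq_addA.
Qed.

Lemma free_addC : commutative free_add.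
Proof.
move=> x y; rewrite -(quot_reprK x) -(quot_reprK y).
by rewrite !free_addE; apply/freeP/feq_addC.
Qed.

Lemma free_add0 : left_id free_zero free_add.
Proof.
by move=> x; rewrite -(quot_reprK x) free_addE; apply/freeP/feq_add0.
Qed.

Lemma free_addN : left_inverse free_zero free_opp free_add.
Proof.
move=> x; rewrite -(quot_reprK x) free_oppE free_addE.
by apply/freeP/feq_addN.
Qed.

Definition freeAb : abGroup :=
  AbGroup free_addA free_addC free_add0 free_addN.

Definition free_gen (x : X) : freeAb := class_of free_eq (FGen x).

Lemma freeAb_ind (P : freeAb -> Prop) :
  (forall x, P (free_gen x)) -> P ab_zero ->
  (forall x, P x -> P (ab_opp x)) ->
  (forall x y, P x -> P y -> P (ab_add x y)) -> forall x, P x.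
Proof.
move=> Pg P0 PN PD x; rewrite -(quot_reprK x); elim: (quot_repr x) => //.
- by move=> y /PN; rewrite /= free_oppE.
- by move=> y Py z Pz; move: (PD _ _ Py Pz); rewrite /= free_addE.
Qed.

Section Lift.
Variables (G : abGroup) (f : X -> G).

Fixpoint free_eval (t : free_term) : G :=
  match t with
  | FGen x => f x
  | FZero => ab_zero
  | FOpp t => ab_opp (free_eval t)
  | FAdd t u => ab_add (free_eval t) (free_eval u)
  end.

Lemma free_eval_eq t u : free_eq t u -> free_eval t = free_eval u.
Proof.
elim=> //=.
- by move=> x y z _ -> _ ->.
- by move=> x y _ ->.
- by move=> x x' y y' _ -> _ ->.
- by move=> x y z; rewrite ab_addA.
- by move=> x y; rewrite ab_addC.
- by move=> x; rewrite ab_add0.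
- by move=> x; rewrite ab_addN.
Qed.

Definition free_lift_fun (x : freeAb) : G := free_eval (quot_repr x).

Lemma free_liftE t : free_lift_fun (class_of free_eq t) = free_eval t.
Proof. exact/free_eval_eq/free_reprP. Qed.

Lemma free_liftD x y :
  free_lift_fun (ab_add x y) = ab_add (free_lift_fun x) (free_lift_fun y).
Proof. by rewrite /= free_liftE. Qed.

Definition free_lift : abHom freeAb G := AbHom free_liftD.

Lemma free_lift_gen x : free_lift (free_gen x) = f x.
Proof. exact: free_liftE. Qed.

End Lift.
End FreeAbelian.

Section QuotientAbelian.
Variables (G : abGroup) (A : G -> Prop).

Inductive gen_subgroup : G -> Prop :=
| gsub_in x : A x -> gen_subgroup x
| gsub_zero : gen_subgroup ab_zero
| gsub_opp x : gen_subgroup x -> gen_subgroup (ab_opp x)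
| gsub_add x y : gen_subgroup x -> gen_subgroup y -> gen_subgroup (ab_add x y).

Definition coset_eq (x y : G) : Prop := gen_subgroup (ab_add x (ab_opp y)).

Lemma coset_refl x : coset_eq x x.
Proof. by rewrite /coset_eq ab_addrN; exact: gsub_zero. Qed.

Lemma coset_sym x y : coset_eq x y -> coset_eq y x.
Proof. by move=> /gsub_opp; rewrite ab_oppD ab_oppK ab_addC. Qed.

Lemma coset_trans x y z : coset_eq x y -> coset_eq y z -> coset_eq x z.
Proof.
move=> xy yz; have := gsub_add xy yz.
by rewrite -ab_addA [ab_add (ab_opp y) _]ab_addA ab_addN ab_add0.
Qed.

Lemma coset_opp x y : coset_eq x y -> coset_eq (ab_opp x) (ab_opp y).
Proof. by move=> /gsub_opp; rewrite ab_oppD. Qed.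

Lemma coset_add x x' y y' :
  coset_eq x x' -> coset_eq y y' -> coset_eq (ab_add x y) (ab_add x' y').
Proof.
by move=> xx yy; have := gsub_add xx yy; rewrite ab_addACA -ab_oppD.
Qed.

Definition qab_sort := classes coset_eq.
Definition qab_zero : qab_sort := class_of coset_eq ab_zero.
Definition qab_opp (x : qab_sort) : qab_sort :=
  class_of coset_eq (ab_opp (quot_repr x)).
Definition qab_add (x y : qab_sort) : qab_sort :=
  class_of coset_eq (ab_add (quot_repr x) (quot_repr y)).

Let qabP := class_ofP coset_refl coset_sym coset_trans.
Let qab_reprP := quot_repr_class coset_refl coset_sym coset_trans.

Lemma qab_oppE x :
  qab_opp (class_of coset_eq x) = class_of coset_eq (ab_opp x).
Proof. by apply/qabP; apply: coset_opp; exact: qab_reprP. Qed.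

Lemma qab_addE x y :
  qab_add (class_of coset_eq x) (class_of coset_eq y) =
  class_of coset_eq (ab_add x y).
Proof. by apply/qabP; apply: coset_add; exact: qab_reprP. Qed.

Lemma qab_addA : associative qab_add.
Proof.
move=> x y z; rewrite -(quot_reprK x) -(quot_reprK y) -(quot_reprK z).
by rewrite !qab_addE ab_addA.
Qed.

Lemma qab_addC : commutative qab_add.
Proof.
by move=> x y; rewrite -(quot_reprK x) -(quot_reprK y) !qab_addE ab_addC.
Qed.

Lemma qab_add0 : left_id qab_zero qab_add.
Proof. by move=> x; rewrite -(quot_reprK x) qab_addE ab_add0. Qed.

Lemma qab_addN : left_inverse qab_zero qab_opp qab_add.
Proof. by move=> x; rewrite -(quot_reprK x) qab_oppE qab_addE ab_addN. Qed.

Definition quotAb : abGroup := AbGroup qab_addA qab_addC qab_add0 qab_addN.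

Definition qab_proj : abHom G quotAb :=
  @AbHom G quotAb (class_of coset_eq) (fun x y => esym (qab_addE x y)).

Lemma qab_surj (x : quotAb) : exists y, qab_proj y = x.
Proof. exact: classes_surj. Qed.

Lemma qab_projP x y : qab_proj x = qab_proj y <-> coset_eq x y.
Proof. exact: qabP. Qed.

Lemma qab_proj_rel x : A x -> qab_proj x = ab_zero.
Proof.
by move=> Ax; apply/qabP; rewrite /coset_eq ab_opp0 ab_addr0; exact: gsub_in.
Qed.

Section Lift.
Variables (H : abGroup) (f : abHom G H) (fA : forall x, A x -> f x = ab_zero).

Lemma gen_subgroup_ker x : gen_subgroup x -> f x = ab_zero.
Proof.
elim=> [y /fA //||y _ fy|y z _ fy _ fz]; first exact: ab_fun0.
- by rewrite ab_funN fy ab_opp0.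
- by rewrite ab_funD fy fz ab_add0.
Qed.

Lemma coset_eq_fun x y : coset_eq x y -> f x = f y.
Proof.
move=> /gen_subgroup_ker; rewrite ab_funD ab_funN => xy.
by apply: (@ab_addIr _ _ _ (ab_opp (f y))); rewrite xy ab_addrN.
Qed.

Definition qab_lift_fun (x : quotAb) : H := f (quot_repr x).

Lemma qab_lift_funE x : qab_lift_fun (class_of coset_eq x) = f x.
Proof. exact/coset_eq_fun/qab_reprP. Qed.

Lemma qab_liftD x y :
  qab_lift_fun (ab_add x y) = ab_add (qab_lift_fun x) (qab_lift_fun y).
Proof. by rewrite /= qab_lift_funE ab_funD. Qed.

Definition qab_lift : abHom quotAb H := AbHom qab_liftD.

Lemma qab_liftE x : qab_lift (qab_proj x) = f x.
Proof. exact: qab_lift_funE. Qed.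

End Lift.
End QuotientAbelian.

Section Localization.
Variables (R : comPzRingType) (S : mulrClosed R).

Definition denom := {s : R | s \in S}.

Definition denom1 : denom := exist _ 1 (rpred1 S).

Lemma denomM_subproof (s t : denom) : sval s * sval t \in S.
Proof. by case: s t => [s Ss] [t St]; apply: rpredM. Qed.

Definition denomM (s t : denom) : denom :=
  exist _ (sval s * sval t) (denomM_subproof s t).

Section LocModule.
Variable M : lmodType R.
Implicit Types x y z : M * denom.

(* [(m, s)] stands for the fraction [m / s]. *)
Definition loc_rel x y : bool :=
  `[< exists2 t, t \in S &
      t *: (sval y.2 *: x.1) = t *: (sval x.2 *: y.1) >].

Lemma loc_rel_equiv : equiv_class_of loc_rel.
Proof.
split=> [x|x y|y x z].
- by apply/asboolP; exists 1; rewrite ?rpred1.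
- by apply/asboolP/asboolP=> -[t St e]; exists t.
- case: x y z => [m [s Ss]] [n [t St]] [p [u Su]].
  move=> /asboolP[v Sv /= e1] /asboolP[w Sw /= e2].
  apply/asboolP; exists (v * w * t); first by rewrite !rpredM.
  transitivity ((w * u) *: (v *: (t *: m))).
    by rewrite /= !scalerA; congr (_ *: _); ring.
  transitivity ((v * s) *: (w *: (u *: n))).
    by rewrite e1 !scalerA; congr (_ *: _); ring.
  by rewrite e2 /= !scalerA; congr (_ *: _); ring.
Qed.

Canonical loc_equiv := EquivRelPack loc_rel_equiv.
Canonical loc_encModRel := defaultEncModRel loc_rel.

Definition loc := {eq_quot loc_rel}.
HB.instance Definition _ : EqQuotient _ loc_rel loc := EqQuotient.on loc.
HB.instance Definition _ := Choice.on loc.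

Definition frac x : loc := \pi_loc x.

Lemma fracP x y : reflect
  (exists2 t, t \in S & t *: (sval y.2 *: x.1) = t *: (sval x.2 *: y.1))
  (frac x == frac y).
Proof. by rewrite /frac eqmodE; apply: asboolP. Qed.

Lemma frac_repr (q : loc) : frac (repr q) = q.
Proof. exact: reprK. Qed.

Lemma repr_frac x : exists2 t, t \in S &
  t *: (sval x.2 *: (repr (frac x)).1) = t *: (sval (repr (frac x)).2 *: x.1).
Proof. by apply/fracP; rewrite frac_repr. Qed.

Definition loc_zero : loc := frac (0, denom1).
Definition loc_opp (p : loc) : loc := frac (- (repr p).1, (repr p).2).
Definition loc_add (p q : loc) : loc :=
  frac (sval (repr q).2 *: (repr p).1 + sval (repr p).2 *: (repr q).1,
        denomM (repr p).2 (repr q).2).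
Definition loc_scale (a : R) (p : loc) : loc :=
  frac (a *: (repr p).1, (repr p).2).

Lemma loc_oppE m s : loc_opp (frac (m, s)) = frac (- m, s).
Proof.
apply/eqP/fracP => /=; have [t St e] := repr_frac (m, s).
by exists t => //; rewrite !scalerN e.
Qed.

Lemma loc_scaleE a m s : loc_scale a (frac (m, s)) = frac (a *: m, s).
Proof.
apply/eqP/fracP => /=; have [t St e] := repr_frac (m, s); exists t => //.
rewrite [LHS](_ : _ = a *: (t *: (sval s *: (repr (frac (m, s))).1))).
  by rewrite e !scalerA /=; congr (_ *: _); ring.
by rewrite !scalerA; congr (_ *: _); ring.
Qed.

Lemma loc_addE m s n t : loc_add (frac (m, s)) (frac (n, t)) =
  frac (sval t *: m + sval s *: n, denomM s t).
Proof.
apply/eqP/fracP => /=.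
have [v Sv] := repr_frac (m, s); have [w Sw] := repr_frac (n, t).
move: (repr _) (repr _) => [m' s'] [n' t'] /= e2 e1.
exists (v * w); first exact: rpredM.
rewrite !scalerDr; congr (_ + _).
  transitivity ((w * sval t * sval t') *: (v *: (sval s *: m'))).
    by rewrite !scalerA; congr (_ *: _); ring.
  by rewrite e1 !scalerA; congr (_ *: _); ring.
transitivity ((v * sval s * sval s') *: (w *: (sval t *: n'))).
  by rewrite !scalerA; congr (_ *: _); ring.
by rewrite e2 !scalerA; congr (_ *: _); ring.
Qed.

Lemma loc_ind (P : loc -> Prop) : (forall m s, P (frac (m, s))) -> forall q, P q.
Proof. by move=> Pf q; rewrite -(frac_repr q); case: (repr q). Qed.

Lemma frac_eq m s n t : sval t *: m = sval s *: n ->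
  frac (m, s) = frac (n, t).
Proof. by move=> e; apply/eqP/fracP; exists 1; rewrite ?rpred1 //= e. Qed.

Lemma loc_addA : associative loc_add.
Proof.
elim/loc_ind=> m s; elim/loc_ind=> n t; elim/loc_ind=> p u.
rewrite !loc_addE; apply: frac_eq; rewrite /= !scalerDr !scalerA addrA.
by congr (_ *: _ + _ *: _ + _ *: _); ring.
Qed.

Lemma loc_addC : commutative loc_add.
Proof.
elim/loc_ind=> m s; elim/loc_ind=> n t; rewrite !loc_addE.
apply: frac_eq; rewrite /= addrC; congr (_ *: _); ring.
Qed.

Lemma loc_add0 : left_id loc_zero loc_add.
Proof.
elim/loc_ind=> m s; rewrite loc_addE; apply: frac_eq.
by rewrite /= scaler0 add0r scale1r mul1r.
Qed.

Lemma loc_addN : left_inverse loc_zero loc_opp loc_add.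
Proof.
elim/loc_ind=> m s; rewrite loc_oppE loc_addE; apply: frac_eq.
by rewrite /= scalerN addNr !scaler0.
Qed.

HB.instance Definition _ :=
  GRing.isZmodule.Build loc loc_addA loc_addC loc_add0 loc_addN.

Lemma loc_scaleA a b (q : loc) :
  loc_scale a (loc_scale b q) = loc_scale (a * b) q.
Proof. by elim/loc_ind: q => m s; rewrite !loc_scaleE scalerA. Qed.

Lemma loc_scale1 : left_id 1 loc_scale.
Proof. by elim/loc_ind=> m s; rewrite loc_scaleE scale1r. Qed.

Lemma loc_scaleDr : right_distributive loc_scale +%R.
Proof.
move=> a; elim/loc_ind=> m s; elim/loc_ind=> n t.
rewrite /GRing.add /= !(loc_scaleE, loc_addE); apply: frac_eq => /=.
by rewrite !scalerDr !scalerA; congr (_ *: _ + _ *: _); ring.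
Qed.

Lemma loc_scaleDl q : {morph loc_scale^~ q : a b / a + b}.
Proof.
elim/loc_ind: q => m s a b.
rewrite [in RHS]/GRing.add /= !(loc_scaleE, loc_addE); apply: frac_eq => /=.
by rewrite !scalerA -scalerDl !scalerA; congr (_ *: _); ring.
Qed.

(* S^-1 M, with its R-module structure: exactness of a localized complex does
   not involve the scalars, so the action of S^-1 R is not recorded. *)
HB.instance Definition _ := GRing.Zmodule_isLmodule.Build R loc
  loc_scaleA loc_scale1 loc_scaleDr loc_scaleDl.

Lemma fracD m s n t : frac (m, s) + frac (n, t) =
  frac (sval t *: m + sval s *: n, denomM s t).
Proof. exact: loc_addE. Qed.

Lemma fracZ a m s : a *: frac (m, s) = frac (a *: m, s).
Proof. exact: loc_scaleE. Qed.

Lemma frac0 s : frac (0, s) = 0.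
Proof. by apply: frac_eq; rewrite !scaler0. Qed.

End LocModule.

Section LocMap.
Variables (M N : lmodType R) (f : {linear M -> N}).

Definition loc_map (p : loc M) : loc N := frac (f (repr p).1, (repr p).2).

Lemma loc_mapE m s : loc_map (frac (m, s)) = frac (f m, s).
Proof.
apply/eqP/fracP => /=; have [t St e] := repr_frac (m, s).
by exists t => //; rewrite -!(linearZ_LR f) e.
Qed.

Lemma loc_map_is_linear : linear loc_map.
Proof.
move=> a; elim/loc_ind=> m s; elim/loc_ind=> n t.
rewrite fracZ fracD !loc_mapE fracZ fracD; congr frac; congr pair.
by rewrite linearD !(linearZ_LR f).
Qed.

HB.instance Definition _ :=
  GRing.isLinear.Build R (loc M) (loc N) _ loc_map loc_map_is_linear.

End LocMap.
End Localization.
Arguments loc_map {R} S {M N} f p.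

(* Complexes concentrated in degrees [i >= 0]; [cdiff C i] is the differential
   from degree [i + 1] to degree [i]. *)
Record complex (R : comPzRingType) := Complex {
  cobj :> nat -> lmodType R;
  cdiff : forall i, {linear cobj i.+1 -> cobj i};
  cdiffK : forall i x, cdiff i (cdiff i.+1 x) = 0
}.

Record chain_map (R : comPzRingType) (C D : complex R) := ChainMap {
  cmap :> forall i, {linear C i -> D i};
  cmapE : forall i x, cmap i (cdiff C i x) = cdiff D i (cmap i.+1 x)
}.

Section Complexes.
Variable R : comPzRingType.
Implicit Types C D : complex R.

(* The differential out of degree 0 is the map to the zero module. *)
Definition is_cycle C (i : nat) : C i -> Prop :=
  match i return C i -> Prop with
  | 0 => fun _ => True
  | j.+1 => fun x => cdiff C j x = 0
  end.

Definition is_boundary C (i : nat) (x : C i) : Prop :=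
  exists y : C i.+1, cdiff C i y = x.

(* Vanishing of the homology in every degree. *)
Definition exact_complex C : Prop :=
  forall i (x : C i), is_cycle x -> is_boundary x.

Definition iso_complex C D : Prop :=
  exists (f : chain_map C D) (g : chain_map D C),
    forall i, cancel (f i) (g i) /\ cancel (g i) (f i).

Lemma iso_complex_refl C : iso_complex C C.
Proof.
have idE i (x : C i.+1) : idfun (cdiff C i x) = cdiff C i (idfun x) by [].
pose id_map := @ChainMap R C C (fun i => idfun) idE.
by exists id_map, id_map.
Qed.

Lemma iso_complex_sym C D : iso_complex C D -> iso_complex D C.
Proof. by case=> f [g fg]; exists g, f => i; case: (fg i). Qed.

Lemma iso_complex_trans C D E :
  iso_complex C D -> iso_complex D E -> iso_complex C E.
Proof.
case=> f [g fg] [f' [g' fg']].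
have ffE i x : (f' i \o f i) (cdiff C i x) = cdiff E i ((f' i.+1 \o f i.+1) x).
  by rewrite /= !cmapE.
have ggE i x : (g i \o g' i) (cdiff E i x) = cdiff C i ((g i.+1 \o g' i.+1) x).
  by rewrite /= !cmapE.
exists (@ChainMap R C E (fun i => f' i \o f i) ffE).
exists (@ChainMap R E C (fun i => g i \o g' i) ggE).
move=> i; case: (fg i) (fg' i) => fgi gfi [fgi' gfi'].
by split=> x /=; rewrite (fgi', gfi) (fgi, gfi').
Qed.

Definition short_exact C' C C'' (f : chain_map C' C) (g : chain_map C C'') :=
  forall i, [/\ injective (f i),
    (forall x, g i x = 0 <-> exists y, f i y = x) &
    (forall z, exists x, g i x = z)].

Definition fin_generated (M : lmodType R) : Prop :=
  exists n (e : 'I_n -> M), forall x, exists a : 'I_n -> R,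
    x = \sum_(i < n) a i *: e i.

Definition projective (M : lmodType R) : Prop :=
  forall (A B : lmodType R) (p : {linear A -> B}) (f : {linear M -> B}),
    (forall b, exists a, p a = b) ->
    exists g : {linear M -> A}, forall x, p (g x) = f x.

Definition zero_module (M : lmodType R) : Prop := forall x : M, x = 0.

Definition perfect C : Prop :=
  (exists N, forall i, (N < i)%N -> zero_module (C i)) /\
  (forall i, fin_generated (C i) /\ projective (C i)).

End Complexes.

Section LocComplex.
Variables (R : comPzRingType) (S : mulrClosed R) (C : complex R).

Lemma loc_cdiffK i (x : loc S (C i.+2)) :
  loc_map S (cdiff C i) (loc_map S (cdiff C i.+1) x) = 0.
Proof. by elim/loc_ind: x => m s; rewrite !loc_mapE cdiffK frac0. Qed.

Definition loc_complex : complex R :=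
  @Complex R (fun i => loc S (C i)) (fun i => loc_map S (cdiff C i)) loc_cdiffK.

End LocComplex.

Inductive enat := Fin of nat | Infty.

Definition le_enat (m n : enat) : bool :=
  match m, n with
  | _, Infty => true
  | Infty, Fin _ => false
  | Fin m, Fin n => (m <= n)%N
  end.

Lemma le_enat_trans m n p : le_enat m n -> le_enat n p -> le_enat m p.
Proof. by case: m n p => [m|] [n|] [p|] //=; apply: leq_trans. Qed.

Section KGroup.
Variables (R : comPzRingType) (d : nat) (S : 'I_d -> mulrClosed R).

Definition S_exact (C : complex R) : Prop :=
  forall i : 'I_d, exact_complex (loc_complex (S i) C).

(* Objects of P(R, n). *)
Definition in_P (n : enat) (C : complex R) : Prop :=
  perfect C /\ (forall i, ~~ le_enat (Fin i) n -> zero_module (C i)).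

Section Level.
Variable n : enat.

Record Kobj := MkKobj {
  Kcomplex :> complex R;
  Kobj_in_P : in_P n Kcomplex;
  Kobj_S_exact : S_exact Kcomplex
}.

Definition Kiso_class := classes (fun P Q : Kobj => iso_complex P Q).

Definition Kiso_of (P : Kobj) : Kiso_class :=
  class_of (fun P Q : Kobj => iso_complex P Q) P.

Definition Kfree : abGroup := freeAb Kiso_class.

Definition Kfree_gen (P : Kobj) : Kfree := free_gen (Kiso_of P).

Inductive Krel : Kfree -> Prop :=
| Krel_ses (P' P P'' : Kobj) (f : chain_map P' P) (g : chain_map P P'') :
    short_exact f g ->
    Krel (ab_add (Kfree_gen P)
                 (ab_opp (ab_add (Kfree_gen P') (Kfree_gen P''))))
| Krel_acyclic (P : Kobj) : exact_complex P -> Krel (Kfree_gen P).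

Definition Kgroup : abGroup := quotAb Krel.

Definition Kclass (P : Kobj) : Kgroup := qab_proj Krel (Kfree_gen P).

End Level.

Section Inclusion.
Variables (k n : enat) (le_kn : le_enat k n).

Lemma in_P_le (C : complex R) : in_P k C -> in_P n C.
Proof.
case=> perfC zC; split=> // i nin; apply: zC; apply: contraNN nin => ik.
exact: le_enat_trans ik le_kn.
Qed.

Definition Kobj_incl (P : Kobj k) : Kobj n :=
  MkKobj (in_P_le (Kobj_in_P P)) (@Kobj_S_exact k P).

Lemma Kiso_ofP m (P Q : Kobj m) :
  Kiso_of P = Kiso_of Q <-> iso_complex P Q.
Proof.
apply: class_ofP => [P'|P' Q'|P' Q' Q'']; first exact: iso_complex_refl.
- exact: iso_complex_sym.
- exact: iso_complex_trans.
Qed.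

(* [P] |-> [P], from isomorphism classes in P(R, k) to those in P(R, n). *)
Definition Kiso_incl (c : Kiso_class k) : Kiso_class n :=
  Kiso_of (Kobj_incl (quot_repr c)).

Lemma Kiso_inclE P : Kiso_incl (Kiso_of P) = Kiso_of (Kobj_incl P).
Proof.
by apply/Kiso_ofP; apply/(@Kiso_ofP k); exact: quot_reprK.
Qed.

Definition Kfree_incl : abHom (Kfree k) (Kgroup n) :=
  free_lift (fun c => qab_proj (@Krel n) (free_gen (Kiso_incl c))).

Lemma Kfree_incl_gen P : Kfree_incl (Kfree_gen P) = Kclass (Kobj_incl P).
Proof. by rewrite free_lift_gen Kiso_inclE. Qed.

Lemma Kfree_incl_rel x : Krel x -> Kfree_incl x = ab_zero.
Proof.
case=> [P' P P'' f g fg|P exP].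
  have /qab_proj_rel <- : Krel (ab_add (Kfree_gen (Kobj_incl P))
      (ab_opp (ab_add (Kfree_gen (Kobj_incl P')) (Kfree_gen (Kobj_incl P''))))).
    exact: (@Krel_ses n (Kobj_incl P') (Kobj_incl P) (Kobj_incl P'') f g fg).
  by rewrite !(ab_funD, ab_funN) !Kfree_incl_gen.
by rewrite Kfree_incl_gen; apply: qab_proj_rel; exact: Krel_acyclic.
Qed.

Definition Kmap : abHom (Kgroup k) (Kgroup n) := qab_lift Kfree_incl_rel.

Lemma KmapE P : Kmap (Kclass P) = Kclass (Kobj_incl P).
Proof. by rewrite [LHS]qab_liftE Kfree_incl_gen. Qed.

End Inclusion.
End KGroup.

(* Main.v *)
From HB Require Import structures.
From mathcomp Require Import all_boot all_order all_algebra.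
From mathcomp Require Import generic_quotient zify boolp.
Require Import Defs.

(** It suffices to treat [k = m >= d] and [n = m + 1]; the case [n = oo] follows
    because every complex and every relation lives in a finite level.

    Let [P] be an S-exact complex in degrees [0, m + 1].  Since [P] is a bounded
    complex of finitely generated projectives, some [s_i] in each [S_i] is
    null-homotopic on [P].  The null-homotopies lift the projection of [P] onto
    its top degree [P_(m+1)] to a map [f] from [P] to the Koszul complex [K] of
    [s_1, ..., s_d] with coefficients in [P_(m+1)], placed in degrees
    [m + 1 - d, m + 1].  This [K] is S-exact, and [K_0 = 0] because [d <= m].  The
    fibre of [f] is split in its top degree, so up to a contractible summand it
    lives in degrees [0, m], as does the shift [K[-1]].  Hence
    [P] = [fib f] - [K[-1]] comes from level [m].

    More generally, any [f : P -> K] that is split injective in degree [m + 1],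
    with [K] S-exact and [K_0 = 0], gives a class [tau fib f] - [K[-1]] in level
    [m].  Two such maps [f], [g] are both compared with [(f, g)], so the class does
    not depend on [f]; choosing the maps compatibly in a short exact sequence
    shows that it is additive. *)

Set Implicit Arguments.
Unset Strict Implicit.
Unset Printing Implicit Defensive.

Import GRing.Theory.
Local Open Scope quotient_scope.
Local Open Scope ring_scope.

(** * Linear maps given by a function and a proof of linearity *)

Section MkLin.
Variables (R : comPzRingType) (M N : lmodType R) (f : M -> N).
Hypothesis linf : linear f.
HB.instance Definition _ := GRing.isLinear.Build R M N _ f linf.
Definition mkLin : {linear M -> N} := f.
Lemma mkLinE x : mkLin x = f x. Proof. by []. Qed.
End MkLin.

(** * Quotients of modules by submodules *)

Section QuotientModule.
Variables (R : comPzRingType) (M : lmodType R).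

Record submod := Submod {
  submod_pred :> M -> Prop;
  submod0 : submod_pred 0;
  submodP : forall a x y,
    submod_pred x -> submod_pred y -> submod_pred (a *: x + y)
}.

Variable B : submod.

Lemma submodD x y : B x -> B y -> B (x + y).
Proof. by move=> Bx By; rewrite -(scale1r x); exact: submodP. Qed.

Lemma submodZ a x : B x -> B (a *: x).
Proof. by move=> Bx; rewrite -[_ *: _]addr0; exact: submodP (submod0 B). Qed.

Lemma submodN x : B x -> B (- x).
Proof. by rewrite -scaleN1r; exact: submodZ. Qed.

Definition mrel (x y : M) : bool := `[< B (x - y) >].

Lemma mrel_equiv : equiv_class_of mrel.
Proof.
split=> [x|x y|y x z].
- by apply/asboolP; rewrite subrr; exact: submod0.
- by apply/asboolP/asboolP=> /submodN; rewrite opprB.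
- move=> /asboolP xy /asboolP yz; apply/asboolP.
  by have := submodD xy yz; rewrite addrA subrK.
Qed.

Canonical mrel_eqv := EquivRelPack mrel_equiv.
Canonical mrel_encModRel := defaultEncModRel mrel.

Definition mquot := {eq_quot mrel}.
HB.instance Definition _ : EqQuotient _ mrel mquot := EqQuotient.on mquot.
HB.instance Definition _ := Choice.on mquot.

Definition mq (x : M) : mquot := \pi_mquot x.

Lemma mq_eq x y : mq x = mq y <-> B (x - y).
Proof.
by rewrite /mq; split=> [/eqP|Bxy]; [|apply/eqP]; rewrite eqmodE;
  [move/asboolP|apply/asboolP].
Qed.

Lemma mq_ind (P : mquot -> Prop) : (forall x, P (mq x)) -> forall q, P q.
Proof. by move=> Pq q; rewrite -[q]reprK; exact: Pq. Qed.

Lemma repr_mq x : B (repr (mq x) - x).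
Proof. by apply/mq_eq; rewrite /mq reprK. Qed.

Definition mquot_opp (p : mquot) : mquot := mq (- repr p).
Definition mquot_add (p q : mquot) : mquot := mq (repr p + repr q).
Definition mquot_scale a (p : mquot) : mquot := mq (a *: repr p).

Lemma mquot_oppE x : mquot_opp (mq x) = mq (- x).
Proof.
by apply/mq_eq; rewrite -opprD; apply: submodN; exact: repr_mq.
Qed.

Lemma mquot_addE x y : mquot_add (mq x) (mq y) = mq (x + y).
Proof.
apply/mq_eq; rewrite opprD addrACA; apply: submodD; exact: repr_mq.
Qed.

Lemma mquot_scaleE a x : mquot_scale a (mq x) = mq (a *: x).
Proof. by apply/mq_eq; rewrite -scalerBr; apply: submodZ; exact: repr_mq. Qed.

Lemma mquot_addA : associative mquot_add.
Proof.
by elim/mq_ind=> x; elim/mq_ind=> y; elim/mq_ind=> z; rewrite !mquot_addE addrA.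
Qed.

Lemma mquot_addC : commutative mquot_add.
Proof. by elim/mq_ind=> x; elim/mq_ind=> y; rewrite !mquot_addE addrC. Qed.

Lemma mquot_add0 : left_id (mq 0) mquot_add.
Proof. by elim/mq_ind=> x; rewrite mquot_addE add0r. Qed.

Lemma mquot_addN : left_inverse (mq 0) mquot_opp mquot_add.
Proof. by elim/mq_ind=> x; rewrite mquot_oppE mquot_addE addNr. Qed.

HB.instance Definition _ :=
  GRing.isZmodule.Build mquot mquot_addA mquot_addC mquot_add0 mquot_addN.

Lemma mquot_scaleA a b (q : mquot) :
  mquot_scale a (mquot_scale b q) = mquot_scale (a * b) q.
Proof. by elim/mq_ind: q => x; rewrite !mquot_scaleE scalerA. Qed.

Lemma mquot_scale1 : left_id 1 mquot_scale.
Proof. by elim/mq_ind=> x; rewrite mquot_scaleE scale1r. Qed.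

Lemma mquot_scaleDr : right_distributive mquot_scale +%R.
Proof.
move=> a; elim/mq_ind=> x; elim/mq_ind=> y.
by rewrite /GRing.add /= !(mquot_scaleE, mquot_addE) scalerDr.
Qed.

Lemma mquot_scaleDl q : {morph mquot_scale^~ q : a b / a + b}.
Proof.
elim/mq_ind: q => x a b.
by rewrite [in RHS]/GRing.add /= !(mquot_scaleE, mquot_addE) scalerDl.
Qed.

HB.instance Definition _ := GRing.Zmodule_isLmodule.Build R mquot
  mquot_scaleA mquot_scale1 mquot_scaleDr mquot_scaleDl.

Lemma mq_is_linear : linear mq.
Proof. by move=> a x y; rewrite -mquot_addE -mquot_scaleE. Qed.

HB.instance Definition _ := GRing.isLinear.Build R M mquot _ mq mq_is_linear.

Lemma mq_eq0 x : mq x = 0 <-> B x.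
Proof. by rewrite -(raddf0 mq) mq_eq subr0. Qed.

(** The lift is [f] applied to chosen representatives; the choice does not matter, since two
    representatives differ by an element of [B]. *)
Lemma mq_lift (N : lmodType R) (f : {linear M -> N}) :
  (forall x, B x -> f x = 0) ->
  {g : {linear mquot -> N} | forall x, g (mq x) = f x}.
Proof.
move=> fB; have fE x : f (repr (mq x)) = f x.
  by apply/subr0_eq; rewrite -raddfB; apply/fB/repr_mq.
have lin : linear (fun q : mquot => f (repr q)).
  move=> a; elim/mq_ind=> x; elim/mq_ind=> y.
  by rewrite -linearP !fE linearP.
by exists (mkLin lin) => x; exact: fE.
Qed.

End QuotientModule.

(** * Modules and complexes *)

Section Modules.
Variable R : comPzRingType.
Implicit Types M N : lmodType R.

Lemma fin_generatedP M : fin_generated M <->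
  exists n (p : {linear 'rV[R]_n -> M}), forall x, exists v, p v = x.
Proof.
split=> [[n [e eP]]|[n [p pP]]].
  have lin : linear (fun v : 'rV[R]_n => \sum_(i < n) v 0 i *: e i).
    move=> a u v; rewrite scaler_sumr -big_split; apply: eq_bigr => i _ /=.
    by rewrite !mxE scalerDl scalerA.
  exists n, (mkLin lin) => x; have [a ->] := eP x.
  by exists (\row_i a i); apply: eq_bigr => i _; rewrite mxE.
exists n, (fun i => p (delta_mx 0 i)) => x; have [v <-] := pP x.
exists (fun i => v 0 i); rewrite {1}[v]row_sum_delta linear_sum.
by apply: eq_bigr => i _; rewrite linearZ_LR.
Qed.

Lemma fin_generated_quot M N (p : {linear M -> N}) :
  (forall y, exists x, p x = y) -> fin_generated M -> fin_generated N.
Proof.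
move=> pS /fin_generatedP[n [q qS]]; apply/fin_generatedP.
exists n, (p \o q) => y; have [x <-] := pS y; have [v <-] := qS x.
by exists v.
Qed.

Lemma fin_generated_prod M N :
  fin_generated M -> fin_generated N -> fin_generated (M * N)%type.
Proof.
move=> /fin_generatedP[m [p pS]] /fin_generatedP[n [q qS]].
apply/fin_generatedP; exists (m + n)%N.
have lin : linear (fun v : 'rV[R]_(m + n) => (p (lsubmx v), q (rsubmx v))).
  by move=> a u v; rewrite !linearP.
exists (mkLin lin) => -[x y]; have [u <-] := pS x; have [v <-] := qS y.
by exists (row_mx u v); rewrite mkLinE row_mxKl row_mxKr.
Qed.

Lemma projective_retract M N (p : {linear M -> N}) (s : {linear N -> M}) :
  cancel s p -> projective M -> projective N.
Proof.
move=> sK projM A B q f qS; have [g gP] := projM A B q (f \o p) qS.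
by exists (g \o s) => x; have := gP (s x); rewrite /= sK.
Qed.

Lemma projective_prod M N :
  projective M -> projective N -> projective (M * N)%type.
Proof.
move=> projM projN A B q f qS.
have lin1 : linear (fun x : M => f (x, 0)).
  move=> a x y; rewrite -linearP; congr (f _).
  by congr pair; rewrite /= scaler0 addr0.
have lin2 : linear (fun y : N => f (0, y)).
  move=> a x y; rewrite -linearP; congr (f _).
  by congr pair; rewrite /= scaler0 addr0.
have [g gP] := projM A B q (mkLin lin1) qS.
have [h hP] := projN A B q (mkLin lin2) qS.
have lin : linear (fun x : M * N => g x.1 + h x.2).
  by move=> a x y; rewrite /= !linearP scalerDr addrACA.
exists (mkLin lin) => -[x y]; rewrite mkLinE raddfD /= gP hP !mkLinE -raddfD.
by congr (f _); congr pair; rewrite /= (addr0, add0r).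
Qed.

Lemma zero_module_fgproj M :
  zero_module M -> fin_generated M /\ projective M.
Proof.
move=> M0; split.
  exists 0, (fun _ => 0) => x; exists (fun _ => 0).
  by rewrite big_ord0; exact: M0.
move=> A B p f _; have lin : linear (fun _ : M => 0 : A).
  by move=> a x y; rewrite scaler0 addr0.
by exists (mkLin lin) => x; rewrite mkLinE raddf0 (M0 x) raddf0.
Qed.

(** The hypotheses say that [e] induces a section of the quotient map, so the quotient is a retract
    of [M]. *)
Lemma mquot_projective M (B : submod M) (e : {linear M -> M}) :
  (forall x, B x -> e x = 0) -> (forall x, B (e x - x)) ->
  projective M -> projective (mquot B).
Proof.
move=> eB eM; have [g gE] := mq_lift eB.
apply: (@projective_retract _ _ (mq B : {linear M -> mquot B}) g).
by elim/mq_ind=> x; rewrite gE; apply/mq_eq.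
Qed.

Lemma mquot_fin_generated M (B : submod M) :
  fin_generated M -> fin_generated (mquot B).
Proof.
apply: (@fin_generated_quot _ _ (mq B : {linear M -> mquot B})).
by elim/mq_ind=> x; exists x.
Qed.

End Modules.

(** * Quotients of complexes by subcomplexes *)

Section QuotientComplex.
Variable R : comPzRingType.

Record subcomplex (C : complex R) := Subcomplex {
  sub_obj :> forall i, submod (C i);
  sub_diff : forall i x, sub_obj i.+1 x -> sub_obj i (cdiff C i x)
}.

Section Quotient.
Variables (C : complex R) (B : subcomplex C).

Let mqL i : {linear C i -> mquot (B i)} := mq (B i).

Lemma cquot_diff_subproof i x : B i.+1 x -> (mqL i \o cdiff C i) x = 0.
Proof. by move=> /sub_diff Bx; apply/mq_eq0. Qed.

Definition cquot_diff i : {linear mquot (B i.+1) -> mquot (B i)} :=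
  sval (mq_lift (@cquot_diff_subproof i)).

Lemma cquot_diffE i x : cquot_diff i (mq (B i.+1) x) = mq (B i) (cdiff C i x).
Proof. by rewrite /cquot_diff; case: mq_lift => g gE /=; rewrite gE. Qed.

Lemma cquot_diffK i x : cquot_diff i (cquot_diff i.+1 x) = 0.
Proof. by elim/mq_ind: x => x; rewrite !cquot_diffE cdiffK raddf0. Qed.

Definition cquot : complex R :=
  @Complex R (fun i => mquot (B i)) cquot_diff cquot_diffK.

Definition cproj : chain_map C cquot :=
  @ChainMap R C cquot mqL (fun i x => esym (cquot_diffE x)).

Lemma cproj_surj i (y : cquot i) : exists x, cproj i x = y.
Proof. by elim/mq_ind: y => x; exists x. Qed.

Lemma cproj_eq0 i x : cproj i x = 0 <-> B i x.
Proof. exact: mq_eq0. Qed.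

Lemma cproj_eq i x y : cproj i x = cproj i y <-> B i (x - y).
Proof. exact: mq_eq. Qed.

End Quotient.

Lemma cquot_map (C D : complex R) (B : subcomplex C) (E : subcomplex D)
    (f : chain_map C D) :
  (forall i x, B i x -> E i (f i x)) ->
  {g : chain_map (cquot B) (cquot E) |
    forall i x, g i (cproj B i x) = cproj E i (f i x)}.
Proof.
move=> fB; have kill i x : B i x -> (cproj E i \o f i) x = 0.
  by move=> /fB Efx; apply/cproj_eq0.
pose g i : {linear cquot B i -> cquot E i} := sval (mq_lift (kill i)).
have gE i x : g i (cproj B i x) = cproj E i (f i x).
  by rewrite /g; case: mq_lift => h hE /=; exact: hE.
have gD i x : g i (cdiff (cquot B) i x) = cdiff (cquot E) i (g i.+1 x).
  by have [x' <-] := cproj_surj x; rewrite gE -!cmapE gE cmapE.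
by exists (ChainMap gD).
Qed.

End QuotientComplex.

(** * Homotopy fibres of chain maps and their functoriality *)

Section Fibre.
Variable R : comPzRingType.

Section Def.
Variables (A B : complex R) (f : chain_map A B).

Definition fib_diff i (x : A i.+1 * B i.+2) : A i * B i.+1 :=
  (cdiff A i x.1, f i.+1 x.1 - cdiff B i.+1 x.2).

Lemma fib_diff_linear i : linear (@fib_diff i).
Proof.
move=> a x y; congr pair; rewrite /= ?linearP //=.
by rewrite scalerBr scalerN addrACA.
Qed.

Lemma fib_diffK i x :
  mkLin (@fib_diff_linear i) (mkLin (@fib_diff_linear i.+1) x) = 0.
Proof.
rewrite !mkLinE; congr pair; rewrite /= ?cdiffK //.
by rewrite raddfB /= cdiffK subr0 cmapE subrr.
Qed.

(* The fibre (shifted mapping cone) of [f].  The summand [B 0] of degree [-1] is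
   lost, so this is only meaningful when [B 0] vanishes. *)
Definition fib : complex R :=
  @Complex R (fun i => (A i * B i.+1)%type)
    (fun i => mkLin (@fib_diff_linear i)) fib_diffK.

Lemma fibE i x :
  cdiff fib i x = (cdiff A i x.1, f i.+1 x.1 - cdiff B i.+1 x.2).
Proof. by []. Qed.

End Def.

Lemma fib_fst (A B : complex R) (f : chain_map A B) :
  {p : chain_map (fib f) A | forall i x, p i x = x.1}.
Proof.
have lin i : linear (fun x : fib f i => x.1 : A i) by [].
have pD i x : mkLin (lin i) (cdiff (fib f) i x) =
  cdiff A i (mkLin (lin i.+1) x) by [].
by exists (ChainMap pD).
Qed.

Lemma fib_map (A B A' B' : complex R) (f : chain_map A B)
    (f' : chain_map A' B') (u : chain_map A A') (v : chain_map B B') :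
  (forall i x, v i (f i x) = f' i (u i x)) ->
  {w : chain_map (fib f) (fib f') |
    forall i x, w i x = (u i x.1, v i.+1 x.2)}.
Proof.
move=> vf; pose w i (x : fib f i) : fib f' i := (u i x.1, v i.+1 x.2).
have wL i : linear (w i) by move=> a x y; congr pair; rewrite /= linearP.
have wD i x : mkLin (wL i) (cdiff (fib f) i x) =
    cdiff (fib f') i (mkLin (wL i.+1) x).
  rewrite !mkLinE; congr pair; rewrite /= ?cmapE //.
  by rewrite raddfB /= vf cmapE.
by exists (ChainMap wD).
Qed.

(** Universal property of the fibre: lifting [g] amounts to giving a null-homotopy [h] of the
    composite of [g] and [f]. Nothing is asked in degree 0, where the fibre has lost [B 0]. *)
Lemma fib_lift (P A B : complex R) (f : chain_map A B) (g : chain_map P A)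
    (h : forall i, {linear P i -> B i.+1}) :
  (forall i x, h i (cdiff P i x) =
     f i.+1 (g i.+1 x) - cdiff B i.+1 (h i.+1 x)) ->
  {w : chain_map P (fib f) | forall i x, w i x = (g i x, h i x)}.
Proof.
move=> hP; pose w i (x : P i) : fib f i := (g i x, h i x).
have wL i : linear (w i) by move=> a x y; rewrite /w !linearP.
have wD i x : mkLin (wL i) (cdiff P i x) = cdiff (fib f) i (mkLin (wL i.+1) x).
  by rewrite !mkLinE; congr pair; rewrite /= ?hP ?cmapE.
by exists (ChainMap wD).
Qed.

(** In degree [i] a fibre is a direct sum, so exactness is checked separately on the first sequence
    in degree [i] and on the second in degree [i.+1]. *)
Lemma fib_ses (A' A A'' B' B B'' : complex R)
    (f' : chain_map A' B') (f : chain_map A B) (f'' : chain_map A'' B'')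
    (u : chain_map A' A) (v : chain_map A A'')
    (w : chain_map B' B) (z : chain_map B B'') :
  (forall i x, w i (f' i x) = f i (u i x)) ->
  (forall i x, z i (f i x) = f'' i (v i x)) ->
  short_exact u v -> short_exact w z ->
  exists (g : chain_map (fib f') (fib f)) (h : chain_map (fib f) (fib f'')),
    short_exact g h.
Proof.
move=> /fib_map[g gE] /fib_map[h hE] uv wz; exists g, h => i.
have [uI uvE vS] := uv i; have [wI wzE zS] := wz i.+1; split.
- by move=> [x y] [x' y']; rewrite !gE => -[/uI -> /wI ->].
- move=> [x y]; rewrite hE /=; split=> [[/uvE[x' <-] /wzE[y' <-]]|].
    by exists (x', y'); rewrite gE.
  by case=> -[x' y']; rewrite gE => -[<- <-]; congr pair;
    [apply/uvE; exists x'|apply/wzE; exists y'].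
- move=> [x y]; have [x' <-] := vS x; have [y' <-] := zS y.
  by exists (x', y'); rewrite hE.
Qed.

End Fibre.

(** * Elementary chain maps and direct sums *)

Section DirectSum.
Variable R : comPzRingType.
Implicit Types A B C P : complex R.

Definition zeroC : complex R :=
  @Complex R (fun=> 'rV[R]_0) (fun=> idfun) (fun _ x => thinmx0 x).

Lemma zeroC_zero i : zero_module (zeroC i).
Proof. by move=> x; exact: thinmx0. Qed.

Lemma zero_map A B : {f : chain_map A B | forall i x, f i x = 0}.
Proof.
have lin i : linear (fun _ : A i => 0 : B i).
  by move=> a x y; rewrite scaler0 addr0.
have fD i x : mkLin (lin i) (cdiff A i x) = cdiff B i (mkLin (lin i.+1) x).
  by rewrite !mkLinE raddf0.
by exists (ChainMap fD).
Qed.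

Lemma id_map A : {f : chain_map A A | forall i x, f i x = x}.
Proof.
have fD i x : idfun (cdiff A i x) = cdiff A i (idfun x) by [].
by exists (@ChainMap R A A (fun=> idfun) fD).
Qed.

Lemma comp_map A B C (f : chain_map A B) (g : chain_map B C) :
  {h : chain_map A C | forall i x, h i x = g i (f i x)}.
Proof.
have hD i x : (g i \o f i) (cdiff A i x) = cdiff C i ((g i.+1 \o f i.+1) x).
  by rewrite /= !cmapE.
by exists (ChainMap hD).
Qed.

Lemma scal_map (s : R) A : {f : chain_map A A | forall i x, f i x = s *: x}.
Proof.
have lin i : linear (fun x : A i => s *: x).
  by move=> a x y; rewrite scalerDr !scalerA mulrC.
have fD i x : mkLin (lin i) (cdiff A i x) = cdiff A i (mkLin (lin i.+1) x).
  by rewrite !mkLinE linearZ_LR.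
by exists (ChainMap fD).
Qed.

Section Def.
Variables A B : complex R.

Definition dsum_diff i (x : A i.+1 * B i.+1) : A i * B i :=
  (cdiff A i x.1, cdiff B i x.2).

Lemma dsum_diff_linear i : linear (@dsum_diff i).
Proof. by move=> a x y; congr pair; rewrite /= linearP. Qed.

Lemma dsum_diffK i x :
  mkLin (@dsum_diff_linear i) (mkLin (@dsum_diff_linear i.+1) x) = 0.
Proof. by rewrite !mkLinE; congr pair; rewrite /= cdiffK. Qed.

Definition dsum : complex R :=
  @Complex R (fun i => (A i * B i)%type)
    (fun i => mkLin (@dsum_diff_linear i)) dsum_diffK.

Lemma dsum_pair P (f : chain_map P A) (g : chain_map P B) :
  {h : chain_map P dsum | forall i x, h i x = (f i x, g i x)}.
Proof.
have lin i : linear (fun x : P i => (f i x, g i x) : dsum i).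
  by move=> a x y; rewrite !linearP.
have hD i x : mkLin (lin i) (cdiff P i x) = cdiff dsum i (mkLin (lin i.+1) x).
  by rewrite !mkLinE; congr pair; rewrite /= cmapE.
by exists (ChainMap hD).
Qed.

Lemma dsum_inl : {f : chain_map A dsum | forall i x, f i x = (x, 0)}.
Proof.
have [f fE] := id_map A; have [g gE] := zero_map A B.
by have [h hE] := dsum_pair f g; exists h => i x; rewrite hE fE gE.
Qed.

Lemma dsum_inr : {f : chain_map B dsum | forall i x, f i x = (0, x)}.
Proof.
have [f fE] := zero_map B A; have [g gE] := id_map B.
by have [h hE] := dsum_pair f g; exists h => i x; rewrite hE fE gE.
Qed.

Lemma dsum_fst : {f : chain_map dsum A | forall i x, f i x = x.1}.
Proof.
have lin i : linear (fun x : dsum i => x.1 : A i) by [].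
have fD i x : mkLin (lin i) (cdiff dsum i x) = cdiff A i (mkLin (lin i.+1) x).
  by [].
by exists (ChainMap fD).
Qed.

Lemma dsum_snd : {f : chain_map dsum B | forall i x, f i x = x.2}.
Proof.
have lin i : linear (fun x : dsum i => x.2 : B i) by [].
have fD i x : mkLin (lin i) (cdiff dsum i x) = cdiff B i (mkLin (lin i.+1) x).
  by [].
by exists (ChainMap fD).
Qed.

Lemma dsum_ses_lr (f : chain_map A dsum) (g : chain_map dsum B) :
  (forall i x, f i x = (x, 0)) -> (forall i x, g i x = x.2) -> short_exact f g.
Proof.
move=> fE gE i; split=> [x y|[x y]|y]; rewrite ?fE ?gE.
- by case.
- by split=> [/= ->|[z]]; [exists x; rewrite fE|rewrite fE => -[]].
- by exists (0, y); rewrite gE.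
Qed.

Lemma dsum_ses_rl (f : chain_map B dsum) (g : chain_map dsum A) :
  (forall i x, f i x = (0, x)) -> (forall i x, g i x = x.1) -> short_exact f g.
Proof.
move=> fE gE i; split=> [x y|[x y]|y]; rewrite ?fE ?gE.
- by case.
- by split=> [/= ->|[z]]; [exists y; rewrite fE|rewrite fE => -[]].
- by exists (y, 0); rewrite gE.
Qed.

End Def.

Definition bij_map A B (f : chain_map A B) :=
  forall i, injective (f i) /\ (forall y, exists x, f i x = y).

(** Lets the relation on short exact sequences identify the classes of isomorphic complexes. *)
Lemma ses_bij_zero A B (f : chain_map A B) (g : chain_map B zeroC) :
  bij_map f -> short_exact f g.
Proof.
move=> fB i; have [fI fS] := fB i; split=> // [x|y].
  by split=> _; [exact: fS|exact: thinmx0].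
by exists 0; rewrite (zeroC_zero y) raddf0.
Qed.

Lemma ses_zero_id A (f : chain_map zeroC A) (g : chain_map A A) :
  (forall i x, g i x = x) -> short_exact f g.
Proof.
move=> gE i; split=> [x y _|x|y].
- by rewrite (zeroC_zero x) (zeroC_zero y).
- rewrite gE; split=> [->|[z <-]]; first by exists 0; rewrite raddf0.
  by rewrite (zeroC_zero z) raddf0.
- by exists y.
Qed.

End DirectSum.

(** * Exactness after inverting scalars, and its inheritance by fibres *)

Section Exactness.
Variable R : comPzRingType.
Implicit Types A B C P F : complex R.

Definition mulclosed (T : R -> Prop) :=
  T 1 /\ forall a b, T a -> T b -> T (a * b).

Lemma mulclosed_mem (S : mulrClosed R) : mulclosed (fun t => t \in S).
Proof. by split=> [|a b]; [exact: rpred1|exact: rpredM]. Qed.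

Lemma mulclosed_one : mulclosed (eq 1).
Proof. by split=> // a b <- <-; rewrite mulr1. Qed.

(** Exactness of the localization at [T], stated without fractions. Taking [T] to be [eq 1] gives
    plain exactness, so both notions are treated by the same lemmas. *)
Definition exact_up_to (T : R -> Prop) C : Prop :=
  forall i (x : C i), is_cycle x -> exists2 t, T t & is_boundary (t *: x).

Lemma exact_up_to1 C : exact_complex C <-> exact_up_to (eq 1) C.
Proof.
split=> exC i x /exC; first by exists 1; rewrite ?scale1r.
by case=> t <-; rewrite scale1r.
Qed.

(** Both directions clear denominators: an equality of fractions becomes an equality in [C] after
    multiplication by its witness and a denominator. *)
Lemma exact_loc (S : mulrClosed R) C :
  exact_complex (loc_complex S C) <-> exact_up_to (fun t => t \in S) C.
Proof.
split=> exC i.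
  move=> x cx; have {cx} cx : is_cycle (frac (x, denom1 S) : loc_complex S C i).
    by case: i x cx => //= i x dx; rewrite loc_mapE dx frac0.
  have [y] := exC _ _ cx; rewrite /=; elim/loc_ind: y => m s.
  rewrite loc_mapE => /eqP/fracP[t St /=]; rewrite scale1r => e.
  exists (t * sval s); first by rewrite rpredM //; exact: (svalP s).
  by exists (t *: m); rewrite linearZ_LR /= e scalerA.
elim/loc_ind=> x s cx.
have [t St ctx] : exists2 t, t \in S & is_cycle (t *: x).
  case: i x cx => [|i] x; first by exists 1; rewrite ?rpred1.
  rewrite /= loc_mapE -(frac0 _ s) => /eqP/fracP[t St /=]; rewrite scaler0 => e.
  exists (t * sval s); first by rewrite rpredM //; exact: (svalP s).
  by rewrite linearZ_LR /= -scalerA e scaler0.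
have [u Su [y dy]] := exC _ _ ctx.
have Suts : u * t * sval s \in S by rewrite !rpredM //; exact: (svalP s).
(* The boundary of [y] is [u * t] times [x], so the denominator [u * t * s] makes it equal to
   [x / s]. *)
exists (frac (y, exist (fun r => r \in S) _ Suts)).
rewrite /= loc_mapE; apply: frac_eq => /=; rewrite dy !scalerA.
by congr (_ *: _); rewrite mulrC ?mulrA.
Qed.

Lemma zero_module_sub (M : lmodType R) (x y : M) : zero_module M -> x = y.
Proof. by move=> M0; rewrite (M0 x) (M0 y). Qed.

Section Fib.
Variables (A B : complex R) (f : chain_map A B).
Hypothesis B0 : zero_module (B 0).

(** In positive degrees these are the two components of a vanishing differential. In degree 0 every
    element is a cycle, and the second equation holds because it takes place in [B 0]. *)
Lemma fib_cycle i (x : fib f i) :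
  is_cycle x -> is_cycle x.1 /\ cdiff B i x.2 = f i x.1.
Proof.
case: i x => [|i] x /=; first by split=> //; exact: zero_module_sub.
by move=> [-> /subr0_eq ->].
Qed.

(** If [t *: x.1] is the boundary of [a], then [f a - t *: x.2] is a cycle of [B]; bounding a
    multiple of it corrects the second component. *)
Lemma fib_exact T : mulclosed T ->
  exact_up_to T A -> exact_up_to T B -> exact_up_to T (fib f).
Proof.
move=> [T1 TM] exA exB i x /fib_cycle[c1 c2].
have [t Tt [a da]] := exA _ _ c1.
have cb : is_cycle (f i.+1 a - t *: x.2).
  by rewrite /= raddfB /= linearZ_LR /= c2 -cmapE da linearZ_LR subrr.
have [u Tu [b db]] := exB _ _ cb.
exists (u * t); first exact: TM.
exists (u *: a, b); rewrite fibE db [x]surjective_pairing /=.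
rewrite !linearZ_LR /= da -scalerDr opprD scalerN opprK addNKr.
by rewrite !scalerA.
Qed.

End Fib.

(** On a cycle [x] the boundary of [x.2] is [s *: x.1], so [s *: x] is the boundary of
    [(x.2, 0)]. *)
Lemma fib_scal_exact (T : R -> Prop) s C (f : chain_map C C) :
  (forall i x, f i x = s *: x) -> zero_module (C 0) -> T s ->
  exact_up_to T (fib f).
Proof.
move=> fE C0 Ts i x /(fib_cycle C0)[_ e]; exists s => //.
by exists (x.2, 0); rewrite fibE e /= raddf0 subr0 !fE.
Qed.

Lemma zero_exact T C : mulclosed T -> (forall i, zero_module (C i)) ->
  exact_up_to T C.
Proof.
move=> [T1 _] C0 i x _; exists 1 => //; exists 0.
exact: zero_module_sub.
Qed.

End Exactness.

(** * Truncations *)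

Section Truncation.
Variable R : comPzRingType.
Implicit Types A B C P F : complex R.

Section Tau.
Variables (m : nat) (F : complex R).

(* [tau] is the good truncation: everything is divided out in degrees above [m],
   the boundaries in degree [m], and nothing below. *)
Definition tau_pred i (x : F i) : Prop :=
  (m < i)%N \/ exists y : F i.+1, ((i < m)%N -> y = 0) /\ cdiff F i y = x.

Lemma tau_pred0 i : @tau_pred i 0.
Proof. by right; exists 0; rewrite raddf0. Qed.

Lemma tau_predP i a (x y : F i) :
  tau_pred x -> tau_pred y -> tau_pred (a *: x + y).
Proof.
case=> [|[x' [x0 <-]]]; first by left.
case=> [|[y' [y0 <-]]]; first by left.
right; exists (a *: x' + y'); rewrite linearP; split=> // im.
by rewrite x0 // y0 // scaler0 addr0.
Qed.

Lemma tau_diff i (x : F i.+1) : tau_pred x -> tau_pred (cdiff F i x).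
Proof.
case=> [mi|[y [_ <-]]]; last by rewrite cdiffK; exact: tau_pred0.
by right; exists x; split=> //; rewrite ltnNge -ltnS mi.
Qed.

Definition tau_sub : subcomplex F :=
  @Subcomplex R F (fun i => Submod (@tau_pred0 i) (@tau_predP i)) tau_diff.

Definition tau : complex R := cquot tau_sub.

Lemma tau_zero i : (m < i)%N -> zero_module (tau i).
Proof. by move=> mi y; have [x <-] := cproj_surj y; apply/cproj_eq0; left. Qed.

Lemma tau_exact T : mulclosed T -> exact_up_to T F -> exact_up_to T tau.
Proof.
move=> [T1 _] exF i y; case: (ltnP m i) => [mi _|im].
  exists 1 => //; exists 0; apply/zero_module_sub/tau_zero; exact: mi.
have [x <-] := cproj_surj y => cx.
(* The differential of [x] lands in a degree below [m], where nothing is divided out, so a cycle of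
   the truncation lifts to a cycle of [F]. *)
have {cx} cx : is_cycle x.
  case: i y x im cx => // i _ x im.
  rewrite /is_cycle -cmapE => /cproj_eq0[|[z [z0 <-]]].
    by rewrite ltnNge ltnW.
  by rewrite z0 // raddf0.
have [t Tt [z dz]] := exF _ _ cx; exists t => //.
by exists (cproj tau_sub i.+1 z); rewrite -cmapE dz linearZ_LR.
Qed.

Lemma tau_id : (forall i, (m < i)%N -> zero_module (F i)) ->
  bij_map (cproj tau_sub).
Proof.
move=> F0 i; split=> [x y|y]; last exact: cproj_surj.
move=> /cproj_eq[/F0 Fi|[z [z0 dz]]].
  exact: zero_module_sub.
apply: subr0_eq; rewrite -dz; case: (ltnP i m) => [/z0 ->|mi].
  by rewrite raddf0.
by rewrite (F0 i.+1 mi z) raddf0.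
Qed.

(** The differentials into degrees [m] and above are split injective. This is what makes the
    cokernel in degree [m] projective. *)
Definition retr_above :=
  exists rho : forall i, {linear F i -> F i.+1},
    forall i x, (m <= i)%N -> rho i (cdiff F i x) = x.

(** In degree [m] the map [x - cdiff (rho x)] kills the boundaries and is the identity modulo them,
    so [mquot_projective] applies. *)
Lemma tau_perfect : retr_above -> perfect F -> perfect tau.
Proof.
move=> [rho rhoE] [_ fgF]; split; first by exists m => i; exact: tau_zero.
move=> i; have [fg proj] := fgF i; split; first exact: mquot_fin_generated.
case: (ltnP m i) => [/tau_zero/zero_module_fgproj[]//|im].
have lin : linear (fun x : F i =>
    if (i < m)%N then x else x - cdiff F i (rho i x)).
  move=> a x y; case: ifP => // _.
  by rewrite !linearP //= scalerBr scalerN addrACA.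
apply: (@mquot_projective _ _ _ (mkLin lin)) proj => x.
  rewrite mkLinE => -[|[y [y0 <-]]]; first by rewrite ltnNge im.
  case: (ltnP i m) => [/y0 ->|mi]; first by rewrite raddf0.
  by rewrite rhoE // subrr.
rewrite mkLinE; case: (ltnP i m) => [_|mi].
  by rewrite subrr; exact: tau_pred0.
right; exists (- rho i x); split; first by rewrite ltnNge mi.
by rewrite raddfN [RHS]addrC addKr.
Qed.

End Tau.

(* The snake lemma: injectivity of the differential of [C] into degree [m] makes
   the right exact sequence of cokernels in degree [m] exact. *)
Lemma tau_ses m A B C (u : chain_map A B) (v : chain_map B C) :
  (forall i, (m <= i)%N -> injective (cdiff C i)) -> short_exact u v ->
  exists (g : chain_map (tau m A) (tau m B))
         (h : chain_map (tau m B) (tau m C)),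
    short_exact g h.
Proof.
move=> injC uv.
have tau_map D E (f : chain_map D E) i x :
    tau_sub m D i x -> tau_sub m E i (f i x).
  case=> [|[y [y0 <-]]]; first by left.
  by right; exists (f i.+1 y); rewrite cmapE; split=> // /y0 ->; rewrite raddf0.
have [g gE] := cquot_map (tau_map _ _ u).
have [h hE] := cquot_map (tau_map _ _ v).
exists g, h => i; have [uI uvE vS] := uv i; have [uI' uvE' vS'] := uv i.+1.
case: (ltnP m i) => [mi|im].
  split=> [x y _|x|y].
  - by apply: zero_module_sub; apply: tau_zero.
  - split=> _; last by apply: zero_module_sub; apply: tau_zero.
    by exists 0; apply: zero_module_sub; apply: tau_zero.
  - by exists 0; apply: zero_module_sub; apply: tau_zero.
split=> [x' y'|y'|z'].
- have [x <-] := cproj_surj x'; have [y <-] := cproj_surj y'.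
  rewrite !gE => /cproj_eq[|[b [b0 db]]]; first by rewrite ltnNge im.
  rewrite -raddfB /= in db; apply/cproj_eq; right.
  case: (ltnP i m) => [im'|mi].
    exists 0; split=> //; apply: uI.
    by rewrite -db b0 // !raddf0.
  (* The boundary of [b] is [u (x - y)], so [v b] has zero differential; injectivity in [C] gives
     [v b = 0], and [b] comes from [A]. *)
  have [|a ua] := (uvE' b).1.
    apply: (injC _ mi); rewrite raddf0 -cmapE db.
    by apply/uvE; exists (x - y).
  exists a; split=> //.
  by apply: uI; rewrite cmapE ua.
- have [y <-] := cproj_surj y'; rewrite hE; split.
    case/cproj_eq0=> [|[c [c0 dc]]]; first by rewrite ltnNge im.
    have [b [b0 vb]] : exists b, ((i < m)%N -> b = 0) /\ v i.+1 b = c.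
      case: (ltnP i m) => im'; first by exists 0; rewrite c0 // raddf0.
      by have [b] := vS' c; exists b.
    (* Subtracting the boundary of [b] keeps the class of [y] in the truncation and brings [y] into
       the kernel of [v]. *)
    have [|a ua] := (uvE (y - cdiff B i b)).1.
      by rewrite raddfB /= cmapE vb dc subrr.
    exists (cproj _ i a); rewrite gE ua; apply/cproj_eq; right.
    exists (- b); split=> [/b0 ->|]; first by rewrite oppr0.
    by rewrite raddfN [RHS]addrC addKr.
  case=> x'; have [x <-] := cproj_surj x'.
  rewrite gE -hE => <-; rewrite hE.
  have -> : v i (u i x) = 0 by apply/uvE; exists x.
  by rewrite raddf0.
- have [z <-] := cproj_surj z'; have [y <-] := vS z.
  by exists (cproj _ i y); rewrite hE.
Qed.

Section Sigma.
Variables (n : nat) (F : complex R).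

(* [sigma] is the brutal truncation to degrees at least [n]. *)
Definition sigma_pred i (x : F i) : Prop := (i < n)%N \/ x = 0.

Lemma sigma_predP i a (x y : F i) :
  sigma_pred x -> sigma_pred y -> sigma_pred (a *: x + y).
Proof.
case=> [|->]; first by left.
case=> [|->]; first by left.
by right; rewrite scaler0 addr0.
Qed.

Lemma sigma_diff i (x : F i.+1) : sigma_pred x -> sigma_pred (cdiff F i x).
Proof. by case=> [/ltnW|->]; [left|right; rewrite raddf0]. Qed.

Definition sigma_sub : subcomplex F :=
  @Subcomplex R F (fun i => Submod (or_intror erefl) (@sigma_predP i))
    sigma_diff.

Definition sigma : complex R := cquot sigma_sub.

Lemma sigma_zero i : (i < n)%N \/ zero_module (F i) -> zero_module (sigma i).
Proof.
move=> + y; have [x <-] := cproj_surj y; case=> [ni|Fi]; apply/cproj_eq0.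
  by left.
by right; exact: Fi.
Qed.

Lemma sigma_retract i : exists r : {linear sigma i -> F i},
  (forall x, (n <= i)%N -> r (cproj sigma_sub i x) = x).
Proof.
have lin : linear (fun x : F i => if (n <= i)%N then x else 0).
  by move=> a x y; case: ifP; rewrite // scaler0 addr0.
have kill x : sigma_sub i x -> mkLin lin x = 0.
  by rewrite mkLinE; case=> [|->]; [rewrite ltnNge => /negbTE->|case: ifP].
have [r rE] := mq_lift kill.
by exists r => x ni; rewrite [LHS]rE mkLinE ni.
Qed.

Lemma sigma_perfect : perfect F -> perfect sigma.
Proof.
move=> [[N F0] fgF]; split.
  by exists N => i /F0 Fi; apply: sigma_zero; right.
move=> i; have [fg proj] := fgF i; split; first exact: mquot_fin_generated.
case: (ltnP i n) => ni.
  by apply: (zero_module_fgproj _).2; apply: sigma_zero; left.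
have [r rE] := sigma_retract i.
apply: (projective_retract (p := cproj sigma_sub i) (s := r)) proj => y.
by have [x <-] := cproj_surj y; rewrite rE.
Qed.

End Sigma.

Lemma zeroC_perfect : perfect (zeroC R).
Proof.
by split=> [|i]; [exists 0 => i _|apply: zero_module_fgproj];
  exact: zeroC_zero.
Qed.

Lemma prod_zero (M N : lmodType R) :
  zero_module M -> zero_module N -> zero_module (M * N)%type.
Proof. by move=> M0 N0 [x y]; rewrite (M0 x) (N0 y). Qed.

Lemma fib_perfect A B (f : chain_map A B) :
  perfect A -> perfect B -> perfect (fib f).
Proof.
move=> [[M A0] fgA] [[N B0] fgB]; split.
  exists (maxn M N) => i; rewrite gtn_max => /andP[Mi Ni].
  by apply: prod_zero; [exact: A0|apply: B0; exact: ltnW].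
move=> i; have [fa pa] := fgA i; have [fb pb] := fgB i.+1.
by split; [exact: fin_generated_prod|exact: projective_prod].
Qed.

Lemma dsum_perfect A B : perfect A -> perfect B -> perfect (dsum A B).
Proof.
move=> [[M A0] fgA] [[N B0] fgB]; split.
  exists (maxn M N) => i; rewrite gtn_max => /andP[Mi Ni].
  by apply: prod_zero; [exact: A0|exact: B0].
move=> i; have [fa pa] := fgA i; have [fb pb] := fgB i.
by split; [exact: fin_generated_prod|exact: projective_prod].
Qed.

Lemma dsum_exact T A B : mulclosed T ->
  exact_up_to T A -> exact_up_to T B -> exact_up_to T (dsum A B).
Proof.
move=> [T1 TM] exA exB i [x y] cxy.
have [cx cy] : is_cycle x /\ is_cycle y by case: i x y cxy => //= i x y [].
have [t Tt [a da]] := exA _ _ cx; have [u Tu [b db]] := exB _ _ cy.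
exists (t * u); first exact: TM.
exists (u *: a, t *: b).
congr pair; rewrite /= linearZ_LR /= ?da ?db scalerA //.
by rewrite mulrC.
Qed.

Definition split_above n A B (f : chain_map A B) :=
  forall i, (n <= i)%N -> exists r : {linear B i -> A i}, cancel (f i) r.

(** In degrees [i >= m] the summand [B i.+2] vanishes, so the differential of the fibre sends
    [(a, 0)] to a pair with second component [f a], from which the splitting of [f] recovers [a]. *)
Lemma fib_retr m A B (f : chain_map A B) :
  split_above m.+1 f -> (forall i, (m.+1 < i)%N -> zero_module (B i)) ->
  retr_above m (fib f).
Proof.
move=> fS B0.
have H i : exists rho : {linear fib f i -> fib f i.+1},
    forall x, (m <= i)%N -> rho (cdiff (fib f) i x) = x.
  case: (leqP m i) => mi; last by exists \0 => x.
  have [r rK] := fS i.+1 mi.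
  have lin : linear (fun x : fib f i => (r x.2, 0) : fib f i.+1).
    by move=> a x y; congr pair; rewrite /= ?linearP // scaler0 addr0.
  have B2 : zero_module (B i.+2) by apply: B0; rewrite !ltnS.
  exists (mkLin lin) => -[a b] _; rewrite mkLinE fibE /= (B2 b).
  by rewrite !raddf0 addr0 rK.
by exists (fun i => sval (cid (H i))) => i x; case: cid => rho /= rhoE /rhoE.
Qed.

(** The second summand is the fibre of an identity: two copies of the top term of [F], in degrees
    [m.+1] and [m]. The map to it is the projection onto [sigma m.+1 F], made null-homotopic by
    [rho]. *)
Lemma retr_split m F : retr_above m F ->
  (forall i, (m.+1 < i)%N -> zero_module (F i)) ->
  forall u : chain_map (sigma m.+1 F) (sigma m.+1 F), (forall i x, u i x = x) ->
  exists f : chain_map F (dsum (tau m F) (fib u)), bij_map f.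
Proof.
move=> [rho rhoE] F0 u uE.
pose p := cproj (sigma_sub m.+1 F).
have hP i x : (p i.+1 \o rho i) (cdiff F i x) =
    u i.+1 (p i.+1 x) - cdiff (sigma m.+1 F) i.+1 ((p i.+2 \o rho i.+1) x).
  rewrite uE /=; case: (ltnP i m) => im.
    by apply/zero_module_sub/sigma_zero; left.
  rewrite rhoE // (F0 i.+2 _ (rho i.+1 x)) ?ltnS //.
  by rewrite !raddf0 addr0.
have [w wE] := fib_lift hP.
have [f fE] := dsum_pair (cproj (tau_sub m F)) w.
exists f => i; have s0 j : (j < m.+1)%N -> zero_module (sigma m.+1 F j).
  by move=> jm; apply: sigma_zero; left.
split=> [x y|[z [a b]]].
  rewrite !fE !wE => -[/cproj_eq e1 /cproj_eq e2 /cproj_eq e3].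
  apply: subr0_eq.
  case: e1 => [mi|[c [c0 dc]]].
    by case: e2 => //; rewrite ltnS leqNgt mi.
  case: (ltnP i m) => im; first by rewrite -dc c0 // raddf0.
  case: e3; first by rewrite ltnS ltnNge im.
  by rewrite -raddfB /= -dc rhoE // => ->; rewrite raddf0.
have [x xz] := cproj_surj (z : tau m F i).
have [y ya] := cproj_surj (a : sigma m.+1 F i).
have [t tb] := cproj_surj (b : sigma m.+1 F i.+1).
case: (ltngtP i m) => [im|mi|im].
- exists x; rewrite fE wE xz; congr (_, (_, _)).
    by apply/zero_module_sub/s0; rewrite ltnS ltnW.
  exact/zero_module_sub/s0.
- exists y; rewrite fE wE [p i y]ya; congr (_, (_, _)).
    by apply/zero_module_sub/tau_zero.
  by apply/zero_module_sub/sigma_zero; right; apply: F0.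
- have mi : (m <= i)%N by rewrite im.
  (* In degree [m], adding a boundary leaves the class in the truncation unchanged, and this one
     turns the value of [rho] into [t]. *)
  exists (x + cdiff F i (t - rho i x)); rewrite fE wE; congr (_, (_, _)).
  + rewrite raddfD -xz -[RHS]addr0; congr (_ + _); apply/cproj_eq0; right.
    by exists (t - rho i x); split=> //; rewrite ltnNge mi.
  + by apply/zero_module_sub/s0; rewrite ltnS im.
  + by rewrite /= [rho i (x + _)]raddfD /= rhoE // addrC subrK.
Qed.

End Truncation.

(** * Null-homotopies and Koszul complexes *)

Section Koszul.
Variable R : comPzRingType.
Implicit Types (T : R -> Prop) (P : complex R).

(** [M] is a retract of a free module of finite rank. Finitely many multipliers bound the images of
    the basis vectors, and their product works for all of them at once. *)
Lemma lift_boundary T P i (M : lmodType R) (phi : {linear M -> P i}) :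
  mulclosed T -> exact_up_to T P -> fin_generated M -> projective M ->
  (forall x, is_cycle (phi x)) ->
  exists2 u, T u &
    exists h : {linear M -> P i.+1}, forall x, cdiff P i (h x) = u *: phi x.
Proof.
move=> [T1 TM] exP /fin_generatedP[n [p pS]] projM cphi.
have [s sK] := projM _ _ p idfun pS.
have H (j : 'I_n) : exists ty : R * P i.+1,
    T ty.1 /\ cdiff P i ty.2 = ty.1 *: phi (p (delta_mx 0 j)).
  by have [t Tt [y dy]] := exP i _ (cphi (p (delta_mx 0 j))); exists (t, y).
have [ty tyP] := choice H; have [Tt dy] := all_and2 tyP.
(* The product over [k != j] completes the multiplier of the [j]-th basis vector to the common
   one. *)
have lin : linear (fun v : 'rV[R]_n =>
    \sum_j v 0 j *: ((\prod_(k | k != j) (ty k).1) *: (ty j).2)).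
  move=> a u v; rewrite scaler_sumr -big_split; apply: eq_bigr => j _ /=.
  by rewrite !mxE scalerDl !scalerA.
exists (\prod_j (ty j).1); first exact: big_ind.
exists (mkLin lin \o s) => x /=; have {2}-> : x = p (s x) by rewrite sK.
move: (s x) => v; rewrite {2}[v]row_sum_delta !raddf_sum /=.
apply: eq_bigr => j _.
have -> : phi (p (v 0 j *: delta_mx 0 j)) = v 0 j *: phi (p (delta_mx 0 j)).
  by rewrite -[RHS]linearZ_LR; congr (phi _); rewrite -[RHS]linearZ_LR.
rewrite [LHS]linearZ_LR !scalerA [_ * v 0 j]mulrC -scalerA; congr (_ *: _).
by rewrite [LHS]linearZ_LR /= dy scalerA mulrC [in RHS](bigD1 j).
Qed.

(* [h] is a null-homotopy of the multiplication by [s]. *)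
Lemma contraction T P : mulclosed T -> exact_up_to T P -> perfect P ->
  exists2 s, T s & exists h : forall i, {linear P i -> P i.+1},
    forall i x, h i (cdiff P i x) = s *: x - cdiff P i.+1 (h i.+1 x).
Proof.
move=> TT exP [[N P0] fgP].
(* The homotopy is built by degrees: stage [N] has the identity in degrees at most [N], and [P]
   vanishes above the last stage. *)
suff [s Ts [h [_ hE]]] : exists2 s, T s &
    exists h : forall i, {linear P i -> P i.+1},
      (forall x, cdiff P 0 (h 0 x) = s *: x) /\
      forall i x, (i < N)%N ->
        h i (cdiff P i x) = s *: x - cdiff P i.+1 (h i.+1 x).
  exists s => //; exists h => i x; case: (ltnP i N) => [|Ni]; first exact: hE.
  by rewrite (P0 i.+1 Ni x) !raddf0 addr0.
elim: N {P0} => [|N [s Ts [h [h0 hE]]]].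
  have [fg0 proj0] := fgP 0.
  have c0 x : is_cycle (idfun x : P 0) by [].
  have [u Tu [h hE]] := lift_boundary TT exP fg0 proj0 c0.
  exists u => //.
  exists (dfwith (fun i => \0 : {linear P i -> P i.+1}) h); split=> //.
  by move=> x; rewrite dfwith_in hE.
(* The part of [s *: x] not yet accounted for in degree [N.+1]. It is a cycle by the identity one
   degree lower, so some multiple [u] of it bounds. *)
pose phi (x : P N.+1) : P N.+1 := s *: x - h N (cdiff P N x).
have phiL : linear phi.
  move=> a x y; rewrite /phi !linearP /=.
  by rewrite [LHS]addrACA !scalerA [s * a]mulrC.
have cphi x : is_cycle (mkLin phiL x).
  rewrite mkLinE /phi /= raddfB /= linearZ_LR /=.
  case: (N) h0 hE x => [|i] h0 hE x; first by rewrite h0 subrr.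
  have := hE i (cdiff P i.+1 x) (ltnSn i).
  rewrite cdiffK raddf0 => /eqP; rewrite eq_sym subr_eq0 => /eqP->.
  by rewrite subrr.
have [fg1 proj1] := fgP N.+1.
have [u Tu [g gE]] := lift_boundary TT exP fg1 proj1 cphi.
exists (u * s); first exact: TT.2.
have scL i : linear (fun x : P i => u *: h i x).
  move=> a x y; rewrite linearP /= scalerDr !scalerA; congr (_ *: _ + _).
  exact: mulrC.
(* The new component is [g]; the earlier ones are rescaled by [u], since the scalar is now
   [u * s]. *)
exists (dfwith (fun i => mkLin (@scL i)) g); split=> [x|i x].
  by rewrite dfwith_out // mkLinE linearZ_LR h0 scalerA.
rewrite ltnS leq_eqVlt => /orP[/eqP iN|iN]; last first.
  rewrite !dfwith_out ?gtn_eqF ?ltnS ?(ltnW iN) // !mkLinE.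
  by rewrite hE // linearZ_LR scalerBr scalerA.
move: x; rewrite iN => x; rewrite dfwith_in dfwith_out ?gtn_eqF //.
by rewrite gE !mkLinE /phi scalerBr scalerA opprB addrC subrK.
Qed.

(* [K] is the Koszul complex on the scalars [s_j], [j] in [l], with coefficients
   in [sigma n P]; each null-homotopy of [s_j] on [P] lifts [f] to the next
   fibre of [s_j]. *)
Lemma koszul (I : eqType) (T : I -> R -> Prop) n P (l : seq I) :
  (forall j, mulclosed (T j)) -> (forall j, exact_up_to (T j) P) ->
  perfect P -> (forall i, (n < i)%N -> zero_module (P i)) -> (size l < n)%N ->
  exists K (f : chain_map P K),
    [/\ perfect K,
        forall i, (n < i)%N \/ (i + size l < n)%N -> zero_module (K i),
        split_above n f & forall j, j \in l -> exact_up_to (T j) K].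
Proof.
move=> TT exP perfP P0; elim: l => [_|j l IHl ln].
  (* Without scalars the target is the top term of [P], placed in degree [n]. *)
  exists (sigma n P), (cproj (sigma_sub n P)); split=> //.
  - exact: sigma_perfect.
  - move=> i; rewrite addn0 => ni; apply: sigma_zero.
    by case: ni => [/P0|]; [right|left].
  - move=> i ni; have [r rE] := sigma_retract n P i.
    by exists r => x; exact: rE.
have [K [f [perfK K0 fS exK]]] := IHl (ltnW ln).
have [s Ts [h hE]] := contraction (TT j) (exP j) perfP.
have [u uE] := scal_map s K.
(* The composite of [h] and [f] is a null-homotopy of [s] times [f], which is what lifts [f] to the
   fibre of [s]. *)
have wP i x : (f i.+1 \o h i) (cdiff P i x) =
    u i.+1 (f i.+1 x) - cdiff K i.+1 ((f i.+2 \o h i.+1) x).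
  by rewrite uE /= hE raddfB /= linearZ_LR cmapE.
have [w wE] := fib_lift wP.
have K00 : zero_module (K 0) by apply: K0; right; rewrite add0n ltnW.
exists (fib u), w; split.
- exact: fib_perfect.
- move=> i /= il; apply: prod_zero; apply: K0.
    case: il => il; [by left|right].
    by apply: leq_trans il; rewrite ltnS leq_add2l leqnSn.
  case: il => il; [left; exact: ltnW|right].
  by rewrite addSnnS.
- move=> i ni; have [r rK] := fS i ni.
  have lin : linear (fun x : fib u i => r x.1) by move=> a x y; rewrite linearP.
  by exists (mkLin lin) => x; rewrite mkLinE wE rK.
(* For the new index, [s] itself annihilates the homology of the fibre; for the old ones exactness
   passes from [K] to the fibre. *)
- move=> k; rewrite inE; case: eqP => [-> _|_ /= /exK exKk].
    exact: fib_scal_exact uE K00 Ts.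
  exact: fib_exact.
Qed.

End Koszul.

(** * Grothendieck groups *)

Section KGroups.
Variables (R : comPzRingType) (d : nat) (S : 'I_d -> mulrClosed R).

Lemma S_exactP (C : complex R) :
  S_exact S C <-> forall j, exact_up_to (fun t => t \in S j) C.
Proof. by split=> H j; apply/exact_loc; exact: H. Qed.

Lemma exact_S_exact (C : complex R) : exact_up_to (eq 1) C -> S_exact S C.
Proof.
move=> exC; apply/S_exactP => j i x /exC[t <- ?].
by exists 1 => //; rewrite rpred1.
Qed.

Lemma in_P_Fin m (C : complex R) : perfect C ->
  (forall i, (m < i)%N -> zero_module (C i)) -> in_P (Fin m) C.
Proof. by move=> perfC C0; split=> // i /=; rewrite -ltnNge; exact: C0. Qed.

Section Level.
Variable n : enat.
Implicit Types P Q : Kobj S n.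

Lemma Kobj_zero m P i : n = Fin m -> (m < i)%N -> zero_module (P i).
Proof.
by move=> nm mi; apply: (Kobj_in_P P).2; rewrite nm /= -ltnNge.
Qed.

Lemma Kclass_ses P' P P'' (f : chain_map P' P) (g : chain_map P P'') :
  short_exact f g -> Kclass P = ab_add (Kclass P') (Kclass P'').
Proof.
move=> fg; have := qab_proj_rel (Krel_ses fg).
rewrite !(ab_funD, ab_funN) => e.
apply: (@ab_addIr _ _ _ (ab_opp (ab_add (Kclass P') (Kclass P'')))).
by rewrite ab_addrN e.
Qed.

Lemma Kclass_exact P : exact_up_to (eq 1) P -> Kclass P = ab_zero.
Proof. by move=> /exact_up_to1 exP; exact: qab_proj_rel (Krel_acyclic exP). Qed.

Lemma zeroC_in_P : in_P n (zeroC R).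
Proof. by split=> [|i _]; [exact: zeroC_perfect|exact: zeroC_zero]. Qed.

Lemma zeroC_exact : exact_up_to (eq 1) (zeroC R).
Proof. exact: zero_exact (mulclosed_one R) (@zeroC_zero R). Qed.

Definition zeroK : Kobj S n := MkKobj zeroC_in_P (exact_S_exact zeroC_exact).

Section DirectSum.
Variables P Q : Kobj S n.

Lemma dsum_in_P : in_P n (dsum P Q).
Proof.
have [perfP P0] := Kobj_in_P P; have [perfQ Q0] := Kobj_in_P Q.
split; first exact: dsum_perfect.
by move=> i ni; apply: prod_zero; [exact: P0|exact: Q0].
Qed.

Lemma dsum_S_exact : S_exact S (dsum P Q).
Proof.
apply/S_exactP => j; apply: dsum_exact; first exact: mulclosed_mem.
  by move: j; apply/S_exactP; exact: (@Kobj_S_exact _ _ _ _ P).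
by move: j; apply/S_exactP; exact: (@Kobj_S_exact _ _ _ _ Q).
Qed.

Definition dsumK : Kobj S n := MkKobj dsum_in_P dsum_S_exact.

End DirectSum.

Lemma Kclass_bij P Q (f : chain_map P Q) : bij_map f -> Kclass P = Kclass Q.
Proof.
move=> fB; have [g _] := zero_map Q (zeroC R).
have := Kclass_ses (P'' := zeroK) (ses_bij_zero g fB).
by rewrite (Kclass_exact (P := zeroK)) ?ab_addr0 //; exact: zeroC_exact.
Qed.

Lemma Kclass_iso P Q : iso_complex P Q -> Kclass P = Kclass Q.
Proof.
case=> f [g fg]; apply: (Kclass_bij (f := f)) => i; have [gf fgi] := fg i.
by split=> [|y]; [exact: can_inj gf|exists (g i y)].
Qed.

Lemma Kgroup_ind (Q : Kgroup S n -> Prop) :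
  (forall P, Q (Kclass P)) -> Q ab_zero ->
  (forall x, Q x -> Q (ab_opp x)) ->
  (forall x y, Q x -> Q y -> Q (ab_add x y)) -> forall x, Q x.
Proof.
move=> QP Q0 QN QD x; have [y <-] := qab_surj x.
elim/freeAb_ind: y => [c||y Qy|y z Qy Qz].
- by have := QP (quot_repr c); rewrite /Kclass /Kfree_gen /Kiso_of quot_reprK.
- by rewrite ab_fun0.
- by rewrite ab_funN; exact: QN.
- by rewrite ab_funD; exact: QD.
Qed.

Lemma Kgroup_hom_eq (H : abGroup) (f g : abHom (Kgroup S n) H) :
  (forall P, f (Kclass P) = g (Kclass P)) -> forall x, f x = g x.
Proof.
move=> fg; elim/Kgroup_ind => [//||x fgx|x y fgx fgy].
- by rewrite !ab_fun0.
- by rewrite !ab_funN fgx.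
- by rewrite !ab_funD fgx fgy.
Qed.

(** Universal property of the K-group. Invariance under isomorphism follows from the two hypotheses,
    an isomorphism being a short exact sequence with third term [zeroK]. *)
Lemma Kgroup_lift (H : abGroup) (e : Kobj S n -> H) :
  (forall P' P P'' (f : chain_map P' P) (g : chain_map P P''),
    short_exact f g -> e P = ab_add (e P') (e P'')) ->
  (forall P, exact_up_to (eq 1) P -> e P = ab_zero) ->
  {h : abHom (Kgroup S n) H | forall P, h (Kclass P) = e P}.
Proof.
move=> e_ses e_exact.
have e_iso P Q : iso_complex P Q -> e P = e Q.
  case=> f [g fg]; have [z _] := zero_map Q (zeroC R).
  have fB : bij_map f.
    move=> i; have [gf fgi] := fg i.
    by split=> [|y]; [exact: can_inj gf|exists (g i y)].
  have := e_ses _ _ zeroK _ _ (ses_bij_zero z fB).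
  by rewrite (e_exact zeroK zeroC_exact) ab_addr0.
pose h0 := free_lift (fun c : Kiso_class S n => e (quot_repr c)).
have h0E P : h0 (Kfree_gen P) = e P.
  by rewrite free_lift_gen; apply/e_iso/(@Kiso_ofP _ _ S)/quot_reprK.
have h0R x : Krel x -> h0 x = ab_zero.
  case=> [P' P P'' f g fg|P /exact_up_to1 /e_exact eP]; last by rewrite h0E.
  by rewrite !(ab_funD, ab_funN) !h0E (e_ses _ _ _ _ _ fg) ab_addrN.
by exists (qab_lift h0R) => P; rewrite [LHS]qab_liftE.
Qed.

End Level.

(** A section [s] of [g] exists by projectivity, and [x - s (g x)] lies in the image of [f]. *)
Lemma ses_retract (A B C : complex R) (f : chain_map A B) (g : chain_map B C)
    i :
  short_exact f g -> projective (C i) ->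
  exists r : {linear B i -> A i}, cancel (f i) r.
Proof.
move=> fg projC; have [fI fgE gS] := fg i.
have [s sK] := projC _ _ (g i) idfun gS.
have H x : exists y, f i y = x - s (g i x).
  by apply/fgE; rewrite raddfB /= sK subrr.
have [r rE] := choice H.
have rL : linear r.
  move=> a x y; apply: fI; rewrite linearP !rE !linearP /=.
  by rewrite [LHS]addrACA -scalerDr.
exists (mkLin rL) => x; apply: fI; rewrite mkLinE rE.
have -> : g i (f i x) = 0 by apply/fgE; exists x.
by rewrite raddf0 subr0.
Qed.

End KGroups.

(** * Auxiliary facts on abelian groups *)

Section AbGroupExtra.
Implicit Types G H K : abGroup.

Lemma ab_sub_eq G (x y z t : G) : ab_add x t = ab_add z y ->
  ab_add x (ab_opp y) = ab_add z (ab_opp t).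
Proof.
move=> e; apply: (@ab_addIr _ _ _ (ab_add t y)).
rewrite ab_addACA ab_addN ab_addr0 e.
by rewrite [ab_add t y]ab_addC ab_addACA ab_addN ab_addr0.
Qed.

Lemma comp_hom G H K (f : abHom G H) (g : abHom H K) :
  {h : abHom G K | forall x, h x = g (f x)}.
Proof.
have hD x y : g (f (ab_add x y)) = ab_add (g (f x)) (g (f y)).
  by rewrite !ab_funD.
by exists (AbHom hD).
Qed.

Lemma id_hom G : {h : abHom G G | forall x, h x = x}.
Proof. by exists (@AbHom G G id (fun _ _ => erefl)). Qed.

End AbGroupExtra.

(** * The step from level [m] to level [m.+1]: split maps, their truncated fibres, and the inverse
    of the inclusion *)

Section Arrows.
Variables (R : comPzRingType) (d : nat) (S : 'I_d -> mulrClosed R) (m : nat).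

Notation Kob := (Kobj S (Fin m.+1)).

(** Vanishing of the target in degree 0 ensures that its fibre loses nothing; splitting in the top
    degree ensures that the truncated fibre is again perfect. *)
Record arrow (A : Kob) := Arrow {
  arr_tgt : Kob;
  arr_tgt0 : zero_module (arr_tgt 0);
  arr_map :> chain_map A arr_tgt;
  arr_split : split_above m.+1 arr_map
}.

Arguments arr_tgt0 {A} a x : rename.

Lemma Kob_zero (A : Kob) i : (m.+1 < i)%N -> zero_module (A i).
Proof. exact: Kobj_zero. Qed.

Section Fib.
Variables (A : Kob) (f : arrow A).

Lemma arr_retr : retr_above m (fib f).
Proof. by apply: fib_retr; [exact: arr_split|move=> i; exact: Kob_zero]. Qed.

Lemma arr_fib_perfect : perfect (fib f).
Proof.
by apply: fib_perfect; [exact: (Kobj_in_P A).1|exact: (Kobj_in_P (arr_tgt f)).1].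
Qed.

Lemma arr_fib_zero i : (m.+1 < i)%N -> zero_module (fib f i).
Proof. by move=> mi; apply: prod_zero; apply: Kob_zero; rewrite // ltnW. Qed.

Lemma arr_fib_exact T : mulclosed T -> exact_up_to T A ->
  exact_up_to T (arr_tgt f) -> exact_up_to T (fib f).
Proof. by move=> *; apply: fib_exact => //; exact: arr_tgt0. Qed.

Lemma arr_fib_S_exact : S_exact S (fib f).
Proof.
apply/S_exactP => j; apply: arr_fib_exact; first exact: mulclosed_mem.
  by have /S_exactP := @Kobj_S_exact _ _ _ _ A.
by have /S_exactP := @Kobj_S_exact _ _ _ _ (arr_tgt f).
Qed.

Lemma arr_tau_S_exact : S_exact S (tau m (fib f)).
Proof.
apply/S_exactP => j; apply: tau_exact; first exact: mulclosed_mem.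
by move: j; apply/S_exactP; exact: arr_fib_S_exact.
Qed.

Definition Kfib : Kob :=
  MkKobj (in_P_Fin arr_fib_perfect arr_fib_zero) arr_fib_S_exact.

Definition Ktau : Kobj S (Fin m) :=
  MkKobj (in_P_Fin (tau_perfect arr_retr arr_fib_perfect) (@tau_zero R m _))
    arr_tau_S_exact.

Definition arr_class : Kgroup S (Fin m) := Kclass Ktau.

Lemma arr_class_exact : exact_up_to (eq 1) A ->
  exact_up_to (eq 1) (arr_tgt f) -> arr_class = ab_zero.
Proof.
move=> exA exK; apply: Kclass_exact; apply: tau_exact.
  exact: mulclosed_one.
by apply: arr_fib_exact => //; exact: mulclosed_one.
Qed.

(* Since [fib f] is split in degrees [m] and [m.+1], it is the direct sum of its
   truncation and of a contractible complex. *)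
Lemma arr_class_incl (le_m : le_enat (Fin m) (Fin m.+1)) :
  Kmap S le_m arr_class = Kclass Kfib.
Proof.
rewrite KmapE; have [u uE] := scal_map 1 (sigma m.+1 (fib f)).
have u1 i x : u i x = x by rewrite uE scale1r.
have [g gB] := retr_split arr_retr arr_fib_zero u1.
pose s := sigma m.+1 (fib f).
have perf_s : perfect s by apply: sigma_perfect; exact: arr_fib_perfect.
have s0 : zero_module (s 0) by apply: sigma_zero; left.
have ex_u : exact_up_to (eq 1) (fib u) by apply: fib_scal_exact uE s0 _.
have u_zero i : (m.+1 < i)%N -> zero_module (fib u i).
  move=> mi; apply: prod_zero; apply: sigma_zero; right; apply: arr_fib_zero => //.
  exact: ltnW.
pose U : Kob := MkKobj (in_P_Fin (fib_perfect u perf_s perf_s) u_zero)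
  (exact_S_exact ex_u).
pose T := Kobj_incl le_m Ktau.
rewrite (Kclass_bij (P := Kfib) (Q := dsumK T U) gB).
have [a aE] := dsum_inl T U; have [b bE] := dsum_snd T U.
rewrite (Kclass_ses (P' := T) (P := dsumK T U) (P'' := U) (dsum_ses_lr aE bE)).
by rewrite (Kclass_exact (P := U) ex_u) ab_addr0.
Qed.

End Fib.

(** Fibres preserve short exact sequences, and so does the truncation, because the retraction for
    [f''] makes the relevant differentials injective. *)
Lemma arr_class_ses (A' A A'' : Kob) (f' : arrow A') (f : arrow A)
    (f'' : arrow A'') (u : chain_map A' A) (v : chain_map A A'')
    (w : chain_map (arr_tgt f') (arr_tgt f))
    (z : chain_map (arr_tgt f) (arr_tgt f'')) :
  (forall i x, w i (f' i x) = f i (u i x)) ->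
  (forall i x, z i (f i x) = f'' i (v i x)) ->
  short_exact u v -> short_exact w z ->
  arr_class f = ab_add (arr_class f') (arr_class f'').
Proof.
move=> wf zf uv wz; have [g [h gh]] := fib_ses wf zf uv wz.
have inj i : (m <= i)%N -> injective (cdiff (fib f'') i).
  by have [rho rhoE] := arr_retr f'' => mi; apply: can_inj => x; exact: rhoE.
have [g' [h' gh']] := tau_ses inj gh.
exact: (Kclass_ses (P' := Ktau f') (P := Ktau f) (P'' := Ktau f'') gh').
Qed.

Notation zK := (zeroK S (Fin m.+1)).

Lemma zero_arrow_split (K : complex R) (f : chain_map zK K) :
  split_above m.+1 f.
Proof.
move=> i _; exists \0 => x; apply: zero_module_sub; exact: zeroC_zero.
Qed.

Section FromZero.
Variables (K : Kob) (K0 : zero_module (K 0)).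

Definition zero_arrow : arrow zK :=
  Arrow K0 (@zero_arrow_split K (sval (zero_map zK K))).

End FromZero.

(** The fibre of this arrow is the target of [f] shifted down by one degree, with the sign of the
    differential changed. *)
Definition arr_zero (A : Kob) (f : arrow A) : arrow zK :=
  zero_arrow (arr_tgt0 f).

(* In level [m.+1] one has [A] = [fib f] - [fib (0 -> arr_tgt f)], and both
   fibres can be truncated to level [m]: this is the inverse of [Kmap]. *)
Definition arr_euler (A : Kob) (f : arrow A) : Kgroup S (Fin m) :=
  ab_add (arr_class f) (ab_opp (arr_class (arr_zero f))).

Lemma arr_pair_split (A : Kob) (B C : complex R) (f : chain_map A B)
    (h : chain_map A (dsum B C)) :
  (forall i x, (h i x).1 = f i x) -> split_above m.+1 f -> split_above m.+1 h.
Proof.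
move=> hf fS i mi; have [r rK] := fS i mi.
have lin : linear (fun x : dsum B C i => r x.1) by move=> a x y; rewrite linearP.
by exists (mkLin lin) => x; rewrite mkLinE hf rK.
Qed.

Section Pair.
Variables (A A'' : Kob) (v : chain_map A A'').
Variables (f : arrow A) (L : Kob) (L0 : zero_module (L 0)) (g : chain_map A'' L).

Let h := dsum_pair f (sval (comp_map v g)).

Lemma arr_pair_spec : split_above m.+1 (sval h).
Proof.
apply: (arr_pair_split (f := f)); last exact: arr_split.
by move=> i x; rewrite /h; case: dsum_pair => h' /= ->.
Qed.

Lemma arr_pair0 : zero_module (dsumK (arr_tgt f) L 0).
Proof. by apply: prod_zero => //; exact: arr_tgt0. Qed.

(** With [v] the identity this compares two arrows on [A]; with [v] the surjection of a short exact
    sequence it combines an arrow on the middle term with one on the quotient. *)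
Definition arr_pair : arrow A :=
  @Arrow A (dsumK (arr_tgt f) L) arr_pair0 (sval h) arr_pair_spec.

Lemma arr_pairE i x : arr_pair i x = (f i x, g i (v i x)).
Proof.
rewrite /= /h; case: dsum_pair => h' /= ->.
by case: comp_map => h'' /= ->.
Qed.

End Pair.

Lemma arr_class_zero_pair (A A'' : Kob) (v : chain_map A A'') (f : arrow A)
    (g : arrow A'') :
  arr_class (arr_zero (arr_pair v f (arr_tgt0 g) g)) =
  ab_add (arr_class (arr_zero f))
    (arr_class (arr_zero g)).
Proof.
have [w wE] := dsum_inl (arr_tgt f) (arr_tgt g).
have [z zE] := dsum_snd (arr_tgt f) (arr_tgt g).
have [i0 i0E] := id_map zK.
pose h := arr_pair v f (arr_tgt0 g) g.
apply: (@arr_class_ses _ _ _ (arr_zero f) (arr_zero h) (arr_zero g) i0 i0 w z).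
- by move=> i x; rewrite (zeroC_zero x) !raddf0.
- by move=> i x; rewrite (zeroC_zero x) !raddf0.
- exact: ses_zero_id.
- exact: dsum_ses_lr.
Qed.

(* The arrow [(f, g)] extends [g] by [0 -> arr_tgt f], and [f] by
   [0 -> arr_tgt g]. *)
Lemma arr_euler_indep (A : Kob) (f g : arrow A) : arr_euler f = arr_euler g.
Proof.
have [i0 i0E] := id_map A.
pose h := arr_pair i0 f (arr_tgt0 g) g.
have [o oE] := zero_map zK A.
have [w wE] := dsum_inl (arr_tgt f) (arr_tgt g).
have [z zE] := dsum_snd (arr_tgt f) (arr_tgt g).
have e1 : arr_class h =
    ab_add (arr_class (arr_zero f)) (arr_class g).
  apply: (@arr_class_ses _ _ _ (arr_zero f) h g o i0 w z).
  - by move=> i x; rewrite (zeroC_zero x) !raddf0.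
  - by move=> i x; rewrite zE arr_pairE i0E.
  - exact: ses_zero_id.
  - exact: dsum_ses_lr.
have [w' w'E] := dsum_inr (arr_tgt f) (arr_tgt g).
have [z' z'E] := dsum_fst (arr_tgt f) (arr_tgt g).
have e2 : arr_class h =
    ab_add (arr_class (arr_zero g)) (arr_class f).
  apply: (@arr_class_ses _ _ _ (arr_zero g) h f o i0 w' z').
  - by move=> i x; rewrite (zeroC_zero x) !raddf0.
  - by move=> i x; rewrite z'E arr_pairE i0E.
  - exact: ses_zero_id.
  - exact: dsum_ses_rl.
apply: ab_sub_eq; rewrite ab_addC -e2 e1; exact: ab_addC.
Qed.

(** The map [u] is degreewise split because [A''] is degreewise projective, and split injections
    compose. *)
Lemma arr_comp (A' A A'' : Kob) (u : chain_map A' A) (v : chain_map A A'')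
    (f : arrow A) : short_exact u v ->
  {f' : chain_map A' (arr_tgt f) |
    split_above m.+1 f' & forall i x, f' i x = f i (u i x)}.
Proof.
move=> uv; have [f' f'E] := comp_map u f; exists f' => // i mi.
have [r rK] := arr_split f mi.
have [s sK] := ses_retract uv ((Kobj_in_P A'').1.2 i).2.
by exists (s \o r) => x; rewrite /= f'E rK sK.
Qed.

(** By independence, [f'] may be replaced by the restriction of [f] to [A'], and [f] by its pairing
    with [f''] after [v]. These arrows form a short exact sequence with [f''], over the direct sum
    sequence of targets. *)
Lemma arr_euler_ses (A' A A'' : Kob) (u : chain_map A' A) (v : chain_map A A'')
    (f' : arrow A') (f : arrow A) (f'' : arrow A'') : short_exact u v ->
  arr_euler f = ab_add (arr_euler f') (arr_euler f'').
Proof.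
move=> uv; have [k kS kE] := arr_comp f uv.
pose g : arrow A' := Arrow (arr_tgt0 f) kS.
pose h := arr_pair v f (arr_tgt0 f'') f''.
rewrite (arr_euler_indep f h) (arr_euler_indep f' g) /arr_euler.
have [w wE] := dsum_inl (arr_tgt f) (arr_tgt f'').
have [z zE] := dsum_snd (arr_tgt f) (arr_tgt f'').
have -> : arr_class h = ab_add (arr_class g) (arr_class f'').
  apply: (@arr_class_ses _ _ _ g h f'' u v w z) => //.
  - move=> i x; rewrite wE arr_pairE kE; congr pair.
    have -> : v i (u i x) = 0 by have [_ uvE _] := uv i; apply/uvE; exists x.
    by rewrite raddf0.
  - by move=> i x; rewrite zE arr_pairE.
  - exact: dsum_ses_lr.
by rewrite arr_class_zero_pair ab_oppD ab_addACA.
Qed.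

(** As [A] vanishes in degree [m.+1], the map from [A] to the zero complex is an arrow; its fibre is
    [A], which the truncation leaves unchanged. *)
Lemma arr_euler_low (A : Kobj S (Fin m)) (le_m : le_enat (Fin m) (Fin m.+1))
    (f : arrow (Kobj_incl le_m A)) : arr_euler f = Kclass A.
Proof.
have [o oE] := zero_map A zK.
have oS : split_above m.+1 o.
  move=> i mi; exists \0 => x; apply: zero_module_sub.
  exact: (Kobj_zero erefl mi).
pose g : arrow (Kobj_incl le_m A) :=
  @Arrow (Kobj_incl le_m A) zK (@zeroC_zero R 0) o oS.
rewrite (arr_euler_indep f g) /arr_euler.
have -> : arr_class (arr_zero g) = ab_zero.
  by apply: arr_class_exact; exact: zeroC_exact.
rewrite ab_opp0 ab_addr0.
have F0 i : (m < i)%N -> zero_module (fib o i).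
  move=> mi; apply: prod_zero; [exact: (Kobj_zero erefl mi)|exact: zeroC_zero].
pose F : Kobj S (Fin m) :=
  MkKobj (in_P_Fin (arr_fib_perfect g) F0) (@arr_fib_S_exact _ g).
have tB : bij_map (cproj (tau_sub m (fib o))) by exact: tau_id.
have -> : arr_class g = Kclass F.
  exact: esym (@Kclass_bij _ _ _ _ F (Ktau g) (cproj (tau_sub m (fib o))) tB).
have [p pE] := fib_fst o.
apply: (@Kclass_bij _ _ _ _ F A p) => i.
split=> [[x y] [x' y']|x]; last by exists (x, 0); rewrite pE.
rewrite !pE /= => ->; congr pair; apply: zero_module_sub.
exact: zeroC_zero.
Qed.

(** The fibre of [f] is an extension of [A] by the fibre of the zero arrow, and truncation does not
    change either class in level [m.+1]. *)
Lemma arr_euler_incl (A : Kob) (f : arrow A)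
    (le_m : le_enat (Fin m) (Fin m.+1)) :
  Kmap S le_m (arr_euler f) = Kclass A.
Proof.
rewrite ab_funD ab_funN !arr_class_incl.
have [g [h gh]] : exists (g : chain_map (fib (arr_zero f)) (fib f))
    (h : chain_map (fib f) A), short_exact g h.
  have [o oE] := zero_map zK A; have [i0 i0E] := id_map (arr_tgt f).
  have [g gE] : {g : chain_map (fib (arr_zero f)) (fib f) |
      forall i x, g i x = (o i x.1, i0 i.+1 x.2)}.
    by apply: fib_map => i x; rewrite (zeroC_zero x) !raddf0.
  have [h hE] := fib_fst f; exists g, h => i; split=> [[x y] [x' y']|[x y]|x].
  - rewrite !gE !i0E => -[_ ->]; congr pair; apply: zero_module_sub.
    exact: zeroC_zero.
  - rewrite hE; split=> [/= ->|[z]].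
      by exists (0, y); rewrite gE i0E raddf0.
    by rewrite gE oE => -[].
  - by exists (x, 0); rewrite hE.
have := Kclass_ses (P' := Kfib (arr_zero f)) (P := Kfib f) (P'' := A) gh.
by move=> ->; rewrite ab_addC ab_addA ab_addN ab_add0.
Qed.

(** Independence allows an arrow with exact target: the Koszul complex on a single scalar taken from
    the system [eq 1]. Its length 1 must be less than [m.+1], whence [0 < m]. *)
Lemma arr_euler_exact (A : Kob) (f : arrow A) : (0 < m)%N ->
  exact_up_to (eq 1) A -> arr_euler f = ab_zero.
Proof.
move=> m0 exA.
have [] := @koszul R unit (fun=> eq 1) m.+1 A [:: tt] _ _ (Kobj_in_P A).1.
- by move=> _; exact: mulclosed_one.
- by [].
- by move=> i; exact: Kob_zero.
- by [].
move=> K [g [perfK K0 gS exK]].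
have {}exK : exact_up_to (eq 1) K by apply: (exK tt); rewrite inE.
have Kz i : (m.+1 < i)%N -> zero_module (K i) by move=> mi; apply: K0; left.
pose L : Kob := MkKobj (in_P_Fin perfK Kz) (exact_S_exact exK).
have L0 : zero_module (L 0) by apply: K0; right.
pose h : arrow A := @Arrow A L L0 g gS.
rewrite (arr_euler_indep f h) /arr_euler !arr_class_exact //.
  by rewrite ab_addrN.
exact: zeroC_exact.
Qed.

(** The Koszul complex on one scalar from each system has length [d < m.+1], so it vanishes in
    degree 0. *)
Lemma arrow_exists (A : Kob) : (d <= m)%N -> exists f : arrow A, True.
Proof.
move=> dm.
have [] := @koszul R 'I_d (fun j t => t \in S j) m.+1 A (enum 'I_d) _ _
  (Kobj_in_P A).1.
- by move=> j; exact: mulclosed_mem.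
- by apply/S_exactP; exact: (@Kobj_S_exact _ _ _ _ A).
- by move=> i; exact: Kob_zero.
- by rewrite size_enum_ord.
move=> K [g [perfK K0 gS exK]].
have {}exK : S_exact S K by apply/S_exactP => j; apply: exK; rewrite mem_enum.
have Kz i : (m.+1 < i)%N -> zero_module (K i) by move=> mi; apply: K0; left.
pose L : Kob := MkKobj (in_P_Fin perfK Kz) exK.
have L0 : zero_module (L 0) by apply: K0; right; rewrite size_enum_ord.
by exists (@Arrow A L L0 g gS).
Qed.

(** Choosing an arrow on each object, [arr_euler] is additive and kills exact complexes, so it
    descends to a left inverse. Surjectivity is [arr_euler_incl]. *)
Lemma Kmap_step (le_m : le_enat (Fin m) (Fin m.+1)) : (0 < d)%N -> (d <= m)%N ->
  injective (Kmap S le_m) /\ forall y, exists x, Kmap S le_m x = y.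
Proof.
move=> d0 dm; have m0 := leq_trans d0 dm; split.
  pose arr (A : Kob) := projT1 (cid (arrow_exists A dm)).
  have [||h hE] := @Kgroup_lift _ _ S (Fin m.+1) _ (fun A => arr_euler (arr A)).
  - by move=> A' A A'' u v; exact: arr_euler_ses.
  - by move=> A; exact: arr_euler_exact.
  apply: (@can_inj _ _ _ h) => x.
  have [c cE] := comp_hom (Kmap S le_m) h; have [i iE] := id_hom (Kgroup S (Fin m)).
  rewrite -cE -[RHS]iE; apply: Kgroup_hom_eq => A.
  by rewrite cE iE KmapE hE arr_euler_low.
elim/Kgroup_ind => [A||y [x <-]|y y' [x <-] [x' <-]].
- have [f _] := arrow_exists A dm.
  by exists (arr_euler f); exact: arr_euler_incl.
- by exists ab_zero; exact: ab_fun0.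
- by exists (ab_opp x); exact: ab_funN.
- by exists (ab_add x x'); exact: ab_funD.
Qed.

End Arrows.

(** * Composition of the one-step isomorphisms and passage to unbounded level *)

Section Stabilization.
Variables (R : comPzRingType) (d : nat) (S : 'I_d -> mulrClosed R).

Lemma Kclass_eq n (P Q : Kobj S n) : Kcomplex P = Kcomplex Q -> Kclass P = Kclass Q.
Proof. by move=> PQ; apply: Kclass_iso; rewrite PQ; exact: iso_complex_refl. Qed.

Lemma Kmap_comp k l n (kl : le_enat k l) (ln : le_enat l n) (kn : le_enat k n) x :
  Kmap S kn x = Kmap S ln (Kmap S kl x).
Proof.
have [c cE] := comp_hom (Kmap S kl) (Kmap S ln).
rewrite -cE; apply: Kgroup_hom_eq => P.
by rewrite cE !KmapE; exact: Kclass_eq.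
Qed.

Lemma Kmap_id k (kk : le_enat k k) x : Kmap S kk x = x.
Proof.
have [i iE] := id_hom (Kgroup S k); rewrite -[RHS]iE.
by apply: Kgroup_hom_eq => P; rewrite iE KmapE; exact: Kclass_eq.
Qed.

Hypothesis d_gt0 : (0 < d)%N.

Lemma Kmap_Fin k n (kn : le_enat (Fin k) (Fin n)) : (d <= k)%N ->
  injective (Kmap S kn) /\ forall y, exists x, Kmap S kn x = y.
Proof.
move=> dk; elim: n kn => [|n IHn] kn.
  have k0 : k = 0 by apply/eqP; rewrite -leqn0; exact: kn.
  subst k; split=> [x y|y]; first by rewrite !Kmap_id.
  by exists y; exact: Kmap_id.
have [ik|kn'] : k = n.+1 \/ le_enat (Fin k) (Fin n).
  by move: (kn); rewrite /= leq_eqVlt => /orP[/eqP|]; [left|right].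
  subst k; split=> [x y|y]; first by rewrite !Kmap_id.
  by exists y; exact: Kmap_id.
have nn : le_enat (Fin n) (Fin n.+1) by rewrite /= leqnSn.
have [inj surj] := IHn kn'.
have [inj' surj'] := Kmap_step S nn d_gt0 (leq_trans dk kn').
split=> [x y|y]; first by rewrite !(Kmap_comp kn' nn) => /inj'/inj.
by have [z <-] := surj' y; have [x <-] := surj z; exists x; exact: Kmap_comp.
Qed.

Lemma in_P_eventually (P : Kobj S Infty) :
  exists N, forall n, (N <= n)%N -> in_P (Fin n) P.
Proof.
have [[[N P0] fgP] _] := Kobj_in_P P; exists N => n Nn.
by apply: in_P_Fin => [|i ni]; [split=> //; exists N|exact: P0 (leq_ltn_trans Nn ni)].
Qed.

(** The left inverse sends [P] to the class in level [k] whose image in every finite level from [k]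
    on that contains [P] is the class of [P]. *)
Lemma Kmap_Infty k (kI : le_enat (Fin k) Infty) : (d <= k)%N ->
  injective (Kmap S kI) /\ forall y, exists x, Kmap S kI x = y.
Proof.
move=> dk.
pose res (P : Kobj S Infty) n (Pn : in_P (Fin n) P) : Kobj S (Fin n) :=
  MkKobj Pn (@Kobj_S_exact _ _ _ _ P).
have res_ex (P : Kobj S Infty) : exists x, forall n (kn : le_enat (Fin k) (Fin n))
    (Pn : in_P (Fin n) P), Kmap S kn x = Kclass (res P n Pn).
  have [N PN] := in_P_eventually P.
  have kM : le_enat (Fin k) (Fin (maxn k N)) by exact: leq_maxl.
  have [x xE] := (Kmap_Fin kM dk).2 (Kclass (res P _ (PN _ (leq_maxr k N)))).
  exists x => n kn Pn.
  (* The class [x] was chosen for level [maxn k N]; for another level [n] the comparison takes place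
     in the larger of the two, to which level [n] injects. *)
  have nM : le_enat (Fin n) (Fin (maxn n (maxn k N))) by exact: leq_maxl.
  have MM : le_enat (Fin (maxn k N)) (Fin (maxn n (maxn k N))).
    exact: leq_maxr.
  apply: (Kmap_Fin nM (leq_trans dk kn)).1.
  rewrite -(Kmap_comp kn nM (le_enat_trans kn nM)) (Kmap_comp kM MM) xE !KmapE.
  exact: Kclass_eq.
pose e P := projT1 (cid (res_ex P)).
have eE (P : Kobj S Infty) n (kn : le_enat (Fin k) (Fin n)) (Pn : in_P (Fin n) P) :
  Kmap S kn (e P) = Kclass (res P n Pn).
  by rewrite /e; case: cid => x /= ->.
split.
  have [||h hE] := @Kgroup_lift _ _ S Infty _ e.
  - move=> P' P P'' f g fg.
    have [N PN] := in_P_eventually P.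
    have [N' PN'] := in_P_eventually P'.
    have [N'' PN''] := in_P_eventually P''.
    (* One finite level contains all three complexes; additivity holds there and is pulled back to
       level [k] by injectivity. *)
    have [] : [/\ k <= N + N' + N'' + k, N <= N + N' + N'' + k,
        N' <= N + N' + N'' + k & N'' <= N + N' + N'' + k]%N.
      by split; lia.
    move: (N + N' + N'' + k)%N => n kn /PN Pn /PN' Pn' /PN'' Pn''.
    have kn' : le_enat (Fin k) (Fin n) by [].
    apply: (Kmap_Fin kn' dk).1.
    rewrite ab_funD !eE.
    exact: (Kclass_ses (P' := res P' n Pn') (P := res P n Pn)
      (P'' := res P'' n Pn'') fg).
  - move=> P exP; have [N PN] := in_P_eventually P.
    have kM : le_enat (Fin k) (Fin (maxn k N)) by exact: leq_maxl.
    apply: (Kmap_Fin kM dk).1; rewrite ab_fun0 (eE P _ kM (PN _ (leq_maxr k N))).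
    exact: (Kclass_exact (P := res P _ _) exP).
  apply: (@can_inj _ _ _ h) => x.
  have [c cE] := comp_hom (Kmap S kI) h; have [i iE] := id_hom (Kgroup S (Fin k)).
  rewrite -cE -[RHS]iE; apply: Kgroup_hom_eq => A; rewrite cE iE KmapE hE.
  (* The defining property of [e] is read at level [k] itself, where [Kmap] is the identity. *)
  have kk : le_enat (Fin k) (Fin k) by exact: leqnn.
  have Ak : in_P (Fin k) (Kobj_incl kI A) by exact: Kobj_in_P A.
  by rewrite -[LHS](Kmap_id kk) (eE _ _ kk Ak); exact: Kclass_eq.
elim/Kgroup_ind => [P||y [x <-]|y y' [x <-] [x' <-]].
- have [N PN] := in_P_eventually P.
  have kM : le_enat (Fin k) (Fin (maxn k N)) by exact: leq_maxl.
  have MI : le_enat (Fin (maxn k N)) Infty by [].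
  exists (e P); rewrite (Kmap_comp kM MI) (eE P _ kM (PN _ (leq_maxr k N))).
  by rewrite KmapE; exact: Kclass_eq.
- by exists ab_zero; exact: ab_fun0.
- by exists (ab_opp x); exact: ab_funN.
- by exists (ab_add x x'); exact: ab_funD.
Qed.

End Stabilization.

Lemma inj_surj_bijective (A B : Type) (f : A -> B) :
  injective f -> (forall y, exists x, f x = y) -> bijective f.
Proof.
move=> fI fS; have [g gK] := choice fS.
by exists g => // x; apply: fI; exact: gK.
Qed.

Local Close Scope ring_scope.

Theorem theorem1p4 (R : comPzRingType) (d : nat) (S : 'I_d -> mulrClosed R)
    (k n : enat) (d_ge1 : 1 <= d) (le_dk : le_enat (Fin d) k)
    (le_kn : le_enat k n) :
  bijective (Kmap S le_kn : abHom (Kgroup S k) (Kgroup S n)).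
Proof.
(* An infinite [k] with a finite [n] is excluded by [le_kn]; when both are infinite the map is the
   identity. *)
case: k n le_dk le_kn => [k|] [n|] //= dk kn.
- by have [inj surj] := Kmap_Fin S d_ge1 kn dk; exact: inj_surj_bijective.
- by have [inj surj] := Kmap_Infty S d_ge1 kn dk; exact: inj_surj_bijective.
- by exists id => x; exact: Kmap_id.
Qed.
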